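(* For all integers $d,m\ge1$ there exist constants $C_{m,d}>0$ and $C'_{m,d}>0$ such that for all $B>0$ and $n\ge1$: if $C_{m,d}Bn^{-m/d}>1$ then $e^{\mathrm{ad\text{-}stoch}}_n(\mathcal F_{d,m,B},S_{\mathrm{samp}},D_{\sup\text{-}\log})\le C'_{m,d}Bn^{-m/d}$, and if $C_{m,d}Bn^{-m/d}\le 1$ then $e^{\mathrm{ad\text{-}stoch}}_n(\mathcal F_{d,m,B},S_{\mathrm{samp}},D_{\sup\text{-}\log})\le C'_{m,d}(C_{m,d}Bn^{-m/d})^{n/2+1}$.
   Context: Let $\mathcal X=[0,1]^d$ with Lebesgue measure. For bounded measurable $f:\mathcal X\to\mathbb R$ let $Z_f=\int_{\mathcal X}e^{f}dx$ and $P_f$ the distribution with density $e^f/Z_f$; $S_{\mathrm{samp}}(f)=P_f$. For $f\in C^m(\mathcal X)$, $\|f\|_{C^m}=\sup_{|\alpha|_1\le m}\|\partial^\alpha f\|_\infty$, $\mathcal F_{d,m,B}=\{f\in C^m(\mathcal X):\|f\|_{C^m}\le B\}$. Sup-log distance: $D_{\sup\text{-}\log}(P,Q)=\|\log(dP/dQ)\|_\infty$ (essential sup over $\mathcal X$), $=\infty$ unless $P,Q$ are mutually absolutely continuous. Stochastic sampling algorithms: given a probability space $(\Omega,P_\Omega)$, a random sample has the form $X_f(\omega)=\tilde\phi(N(f,\omega),\omega)\in\mathcal X$, where $N(f,\omega)=(f(x_1),\dots,f(x_n))$ with each point $x_k$ allowed to depend on $\omega$ and on $f(x_1),\dots,f(x_{k-1})$;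 the associated map $\tilde S$ sends $f$ to the distribution of $X_f(\omega)$ for $\omega\sim P_\Omega$. $\mathcal A^{\mathrm{ad\text{-}stoch}}_n$ is the set of all such $\tilde S$ using $n$ evaluations, and $e^{\mathrm{ad\text{-}stoch}}_n(\mathcal F,S_{\mathrm{samp}},D)=\inf_{\tilde S\in\mathcal A^{\mathrm{ad\text{-}stoch}}_n}\sup_{f\in\mathcal F}D(P_f,\tilde S(f))$. *)

(* Defs.v *)
From HB Require Import structures.
From mathcomp Require Import all_boot all_order all_algebra.
From mathcomp Require Import all_classical all_reals all_analysis.
Set Implicit Arguments. Unset Strict Implicit. Unset Printing Implicit Defensive.
Import Order.TTheory GRing.Theory Num.Theory.
Import numFieldNormedType.Exports.
Local Open Scope classical_set_scope.
Local Open Scope ring_scope.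

Definition rV_display : measure_display. Proof. exact: default_measure_display. Qed.

Section rV_measurable.
Context (R : realType) (d : nat).
Let coor : 'I_d -> 'rV[R]_d -> measurableTypeR R := fun i x => x ord0 i.
Let rV_set0 : g_sigma_preimage coor set0.
Proof. exact: sigma_algebra0. Qed.
Let rV_setC A : g_sigma_preimage coor A -> g_sigma_preimage coor (~` A).
Proof. exact: sigma_algebraC. Qed.
Let rV_bigcup (F : _^nat) : (forall i, g_sigma_preimage coor (F i)) ->
  g_sigma_preimage coor (\bigcup_i (F i)).
Proof. exact: sigma_algebra_bigcup. Qed.
HB.instance Definition _ := @isMeasurable.Build rV_display
  'rV[R]_d (g_sigma_preimage coor) rV_set0 rV_setC rV_bigcup.
End rV_measurable.

Section defs.
Context (R : realType).

Definition cube (d : nat) : set 'rV[R]_d :=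
  [set x | forall i : 'I_d, 0 <= x ord0 i <= 1].
Arguments cube : clear implicits.

(* ---------- d-dimensional Lebesgue integral of nonnegative functions,
   defined as the iterated one-dimensional Lebesgue integral (Tonelli) *)
Fixpoint lebI (n : nat) : (n.-tuple R -> \bar R) -> \bar R :=
  match n return (n.-tuple R -> \bar R) -> \bar R with
  | 0 => fun g => g [tuple]
  | n'.+1 => fun g =>
      (\int[@lebesgue_measure R]_x lebI (fun t : n'.-tuple R => g (cons_tuple x t)))%E
  end.

Definition leb_int (d : nat) (g : 'rV[R]_d -> \bar R) : \bar R :=
  lebI (fun t : d.-tuple R => g (\row_i tnth t i)).

Definition Zf (d : nat) (f : 'rV[R]_d -> R) : \bar R :=
  leb_int (fun x => ((\1_(cube d) x : R) * expR (f x))%:E).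

Definition Pf (d : nat) (f : 'rV[R]_d -> R) : set 'rV[R]_d -> \bar R :=
  fun A => (fine (leb_int (fun x => ((\1_(A `&` cube d) x : R) * expR (f x))%:E))
            / fine (Zf f))%:E.

(* ---------- sup-log distance:  || log (dP/dQ) ||_oo (ess. sup w.r.t. Q),
   +oo unless P and Q are mutually absolutely continuous.  A density dP/dQ is
   a measurable h with P A = \int_A h dQ; mutual absolute continuity is
   exactly the existence of such an h with h > 0. *)
Definition D_suplog (d : nat) (P : set 'rV[R]_d -> \bar R)
  (Q : {measure set 'rV[R]_d -> \bar R}) : \bar R :=
  ereal_inf [set e : \bar R | exists h : 'rV[R]_d -> R,
    [/\ measurable_fun setT h, (forall x, 0 < h x),
        (forall A, measurable A -> P A = (\int[Q]_(x in A) (h x)%:E)%E) &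
        (\forall x \ae Q, ((`|ln (h x)|)%:E <= e)%E)]].

Definition evec (d : nat) (i : 'I_d) : 'rV[R]_d := delta_mx ord0 i.

Definition dpart (d : nat) (s : seq 'I_d) (f : 'rV[R]_d -> R) : 'rV[R]_d -> R :=
  foldr (fun i g => 'D_(evec i) g) f s.

Definition dalpha (d : nat) (alpha : 'I_d -> nat) (f : 'rV[R]_d -> R) :=
  dpart (flatten [seq nseq (alpha i) i | i <- enum 'I_d]) f.

Definition Cm (d m : nat) (f : 'rV[R]_d -> R) : Prop :=
  [/\ {within cube d, continuous f},
      (forall (s : seq 'I_d) i x, (size s < m)%N -> interior (cube d) x ->
         derivable (dpart s f) x (evec i)) &
      (forall s : seq 'I_d, (size s <= m)%N ->
         (forall x, interior (cube d) x -> {for x, continuous (dpart s f)}) /\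
         exists g : 'rV[R]_d -> R, {within cube d, continuous g} /\
           (forall x, interior (cube d) x -> dpart s f x = g x))].

Definition Cm_norm_le (d m : nat) (f : 'rV[R]_d -> R) (B : R) : Prop :=
  forall alpha : 'I_d -> nat, (\sum_i alpha i <= m)%N ->
    forall x, interior (cube d) x -> `|dalpha alpha f x| <= B.

Definition Fclass (d m : nat) (B : R) : set ('rV[R]_d -> R) :=
  [set f | Cm m f /\ Cm_norm_le m f B].

Record stoch_alg (d : nat) (Omega : Type) := StochAlg {
  next_pt : Omega -> seq R -> 'rV[R]_d ;
  out_pt : Omega -> seq R -> 'rV[R]_d }.

Definition info (d : nat) (Omega : Type) (A : stoch_alg d Omega)
    (f : 'rV[R]_d -> R) (w : Omega) (n : nat) : seq R :=
  iter n (fun ys => rcons ys (f (next_pt A w ys))) [::].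

Definition sample (d : nat) (Omega : Type) (A : stoch_alg d Omega) (n : nat)
    (f : 'rV[R]_d -> R) (w : Omega) : 'rV[R]_d :=
  out_pt A w (info A f w n).

Definition alg_in_cube (d : nat) (Omega : Type) (A : stoch_alg d Omega) :=
  (forall w ys, cube d (next_pt A w ys)) /\ (forall w ys, cube d (out_pt A w ys)).

Definition alg_error (d : nat) (dO : measure_display) (Omega : measurableType dO)
    (PO : probability Omega R) (A : stoch_alg d Omega) (n : nat)
    (F : set ('rV[R]_d -> R)) : \bar R :=
  ereal_sup [set e | exists f, F f /\ exists g : {mfun Omega >-> 'rV[R]_d},
     (g : Omega -> 'rV[R]_d) = sample A n f /\ e = D_suplog (Pf f) (distribution PO g)].

Definition err_adstoch (d n : nat) (F : set ('rV[R]_d -> R)) : \bar R :=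
  ereal_inf [set e | exists (dO : measure_display) (Omega : measurableType dO)
     (PO : probability Omega R) (A : stoch_alg d Omega),
     [/\ alg_in_cube A,
         (forall f, F f -> measurable_fun setT (sample A n f)) &
         e = alg_error PO A n F]].

End defs.

(* Main.v *)
(* At most half of the n evaluations are spent on a grid, and fhat is any member of the
   class with the same grid values. Two members of the class that agree on the grid differ
   by O(B n^(-m/d)): this is a one-dimensional estimate applied to one coordinate after the
   other. The remaining k >= n/2 evaluations serve k rounds of rejection sampling for
   exp f, with proposals whose log-density is known and O(eps)-close to fhat up to an
   additive constant; if all rounds reject, the output is a fresh proposal. A round
   rejects with probability q = O(eps), so the density of the output relative to P_f is
   1 + q^k (p/p_f - 1), where p is the proposal density and p/p_f = 1 + O(eps); hence the
   error O(eps^(k+1)). *)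

Require Import Defs.
From HB Require Import structures.
From mathcomp Require Import all_boot all_order all_algebra.
From mathcomp Require Import all_classical all_reals all_analysis.
From mathcomp Require Import measurable_realfun.
From mathcomp Require Import ring lra zify.
Import Order.TTheory GRing.Theory Num.Theory.
Import numFieldNormedType.Exports.
Local Open Scope classical_set_scope.
Local Open Scope ring_scope.
Set Implicit Arguments. Unset Strict Implicit. Unset Printing Implicit Defensive.

Section geometric_sum.
Context (R : numDomainType).
Implicit Types (q : R) (k : nat).

Definition geom_sum q k : R := \sum_(i < k) q ^+ i.

Lemma geom_sum0 q : geom_sum q 0 = 0.
Proof. exact: big_ord0. Qed.

Lemma geom_sumS q k : geom_sum q k.+1 = 1 + q * geom_sum q k.
Proof.
rewrite /geom_sum big_ord_recl expr0 mulr_sumr; congr (_ + _).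
by apply: eq_bigr => i _; rewrite exprS.
Qed.

Lemma geom_sum_ge0 q k : 0 <= q -> 0 <= geom_sum q k.
Proof. by move=> q0; apply: sumr_ge0 => i _; rewrite exprn_ge0. Qed.

Lemma mul1B_geom_sum q k : (1 - q) * geom_sum q k = 1 - q ^+ k.
Proof. by rewrite -[1 - q]opprB mulNr -subrX1 opprB. Qed.

End geometric_sum.

(** * Stability of the values of a function from its values at nodes *)

Section one_dimension.
Context (R : realType).
Implicit Types (I : set R) (f df : R -> R) (s : nat -> R).

Lemma is_interval_MVT I f df (x y : R) : is_interval I ->
  (forall z, I z -> is_derive z 1 f (df z)) -> I x -> I y -> x <= y ->
  exists2 z, x <= z <= y & f y - f x = df z * (y - x).
Proof.
move=> itvI dI Ix Iy xy; have Ixy z : x <= z <= y -> I z by exact: itvI.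
have [||z zxy ->] := @MVT_segment R f df x y xy.
- by move=> z; rewrite in_itv /= => /andP[xz zy]; apply/dI/Ixy; rewrite !ltW.
- apply: derivable_within_continuous => z; rewrite in_itv /= => xzy.
  by have [] := dI z (Ixy _ xzy).
- by exists z => //; move: zxy; rewrite in_itv.
Qed.

Lemma lipschitz_of_derivative_le I f df (b x y : R) : is_interval I ->
  (forall z, I z -> is_derive z 1 f (df z)) ->
  (forall z, I z -> `|df z| <= b) -> I x -> I y ->
  `|f x - f y| <= b * `|x - y|.
Proof.
move=> itvI dI bI; wlog xy : x y / x <= y => [wl Ix Iy|Ix Iy].
  have [xy|/ltW yx] := leP x y; first exact: wl.
  by rewrite distrC (distrC x) wl.
have [z zxy fxy] := is_interval_MVT itvI dI Ix Iy xy.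
rewrite distrC fxy normrM (distrC y) ler_wpM2r //.
exact/bI/(itvI _ _ Ix Iy).
Qed.

Definition small_at_separated_nodes I (h e : R) (n : nat) f s :=
  (forall j, (j < n)%N -> I (s j) /\ `|f (s j)| <= e) /\
  (forall j, (j.+1 < n)%N -> s j + h <= s j.+1).

Lemma derivative_small_between I f df (h e x y : R) : is_interval I -> 0 < h ->
  (forall z, I z -> is_derive z 1 f (df z)) ->
  I x -> I y -> x + h <= y -> `|f x| <= e -> `|f y| <= e ->
  exists z, x <= z <= y /\ I z /\ `|df z| <= 2 * e / h.
Proof.
move=> itvI h0 dI Ix Iy xhy fx fy.
have xy : x <= y by rewrite (le_trans _ xhy) // lerDl ltW.
have [z zxy fxy] := is_interval_MVT itvI dI Ix Iy xy.
exists z; split=> //; split; first exact: itvI zxy.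
rewrite ler_pdivlMr //; apply: (@le_trans _ _ `|df z * (y - x)|).
  by rewrite normrM ler_wpM2l //; apply: le_trans (ler_norm _); lra.
by rewrite -fxy (le_trans (ler_normB _ _)) //; lra.
Qed.

(* Skipping every other gap keeps the nodes of the derivative h-separated. *)
Lemma derivative_small_at_separated_nodes I f df s (h e : R) (n : nat) :
  is_interval I -> 0 < h -> (forall z, I z -> is_derive z 1 f (df z)) ->
  small_at_separated_nodes I h e n.*2 f s ->
  exists s', small_at_separated_nodes I h (2 * e / h) n df s'.
Proof.
move=> itvI h0 dI [small sep].
have /choice[s' hs'] j : exists z, (j < n)%N ->
    s j.*2 <= z <= s j.*2.+1 /\ I z /\ `|df z| <= 2 * e / h.
  have [jn|_] := ltnP j n; last by exists 0.
  have j1 : (j.*2.+1 < n.*2)%N by lia.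
  have [I0 b0] := small _ (ltnW j1); have [I1 b1] := small _ j1.
  have [z hz] := derivative_small_between itvI h0 dI I0 I1 (sep _ j1) b0 b1.
  by exists z.
exists s'; split=> [j jn|j jn]; first by have [_] := hs' j jn.
have [/andP[_ le1] _] := hs' j (ltnW jn); have [/andP[le2 _] _] := hs' j.+1 jn.
have : (j.*2.+2 < n.*2)%N by lia.
by move/sep; move: le2; rewrite doubleS; lra.
Qed.

Lemma small_of_small_at_separated_nodes I (phi : nat -> R -> R) s (q L h M e : R) (m : nat) :
  is_interval I -> 0 < h -> 0 <= L -> L <= q * h -> 0 <= e ->
  (forall u v, I u -> I v -> `|u - v| <= L) ->
  (forall k z, (k < m)%N -> I z -> is_derive z 1 (phi k) (phi k.+1 z)) ->
  (forall z, I z -> `|phi m z| <= M) ->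
  small_at_separated_nodes I h e (2 ^ m) (phi 0) s ->
  forall z, I z -> `|phi 0%N z| <= geom_sum (2 * q) m * e + M * L ^+ m.
Proof.
move=> itvI h0 L0 Lqh e0 diamI.
have q0 : 0 <= q by rewrite -(pmulr_lge0 _ h0) (le_trans L0).
elim: m phi s e e0 => [|m ih] phi s e e0 dphi bphi small z Iz.
  by rewrite geom_sum0 mul0r add0r expr0 mulr1; exact: bphi.
have d0 u (Iu : I u) : is_derive u 1 (phi 0) (phi 1 u) by exact: dphi.
have [s' small'] : exists s', small_at_separated_nodes I h (2 * e / h) (2 ^ m) (phi 1) s'.
  apply: derivative_small_at_separated_nodes d0 _ => //.
  by rewrite -mul2n -expnS; exact: small.
have [Is small0] : I (s 0%N) /\ `|phi 0%N (s 0%N)| <= e.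
  by case: small => /(_ 0%N) h0s _; apply: h0s; rewrite expn_gt0.
pose b := geom_sum (2 * q) m * (2 * e / h) + M * L ^+ m.
have b1 u : I u -> `|phi 1%N u| <= b.
  apply: (ih (phi \o S) s') => //; first by rewrite divr_ge0 ?mulr_ge0 // ltW.
  by move=> k y km; exact: dphi.
have b0 : 0 <= b by exact: le_trans (normr_ge0 _) (b1 _ Is).
have zs : `|phi 0%N z| <= e + b * L.
  rewrite -[phi 0%N z](subrK (phi 0%N (s 0%N))) addrC.
  rewrite (le_trans (ler_normD _ _)) // lerD //.
  apply: le_trans (lipschitz_of_derivative_le itvI d0 b1 Iz Is) _.
  by rewrite ler_wpM2l // diamI.
apply: le_trans zs _; rewrite geom_sumS /b.
have -> : e + (geom_sum (2 * q) m * (2 * e / h) + M * L ^+ m) * L =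
    e + 2 * (L / h) * (geom_sum (2 * q) m * e) + M * L ^+ m.+1 by rewrite exprSr; ring.
rewrite [(1 + _) * e]mulrDl mul1r -[2 * q * _ * e]mulrA lerD2r lerD2l.
rewrite ler_wpM2r ?mulr_ge0 ?geom_sum_ge0 ?mulr_ge0 // ler_wpM2l //.
by rewrite ler_pdivrMr.
Qed.

End one_dimension.

Section grid.
Context (R : realType) (d : nat).
Implicit Types (x : 'rV[R]_d) (i j : 'I_d) (f g : 'rV[R]_d -> R).

Definition open_cube : set 'rV[R]_d := [set x | forall i, 0 < x ord0 i < 1].

Lemma open_cube_sub_cube : open_cube `<=` @cube R d.
Proof. by move=> x ox i; have /andP[x0 x1] := ox i; rewrite !ltW. Qed.

Lemma open_cube_sub_interior : open_cube `<=` (@cube R d)°.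
Proof.
move=> x ox; rewrite /interior /=.
apply: (@filter_forall _ _ (fun i (y : 'rV[R]_d) => 0 <= y ord0 i <= 1 : Prop) _
  (@nbhs_filter _ x)) => i.
have xi : nbhs (x ord0 i) `]0, 1[%classic.
  apply: open_nbhs_nbhs; split; first exact: interval_open.
  by rewrite /= in_itv; exact: ox.
apply: (@filterS _ (nbhs x) _ _ _ _ (@coord_continuous R 1 d ord0 i x _ xi)) => y /=.
by rewrite in_itv /= => /andP[y0 y1]; rewrite !ltW.
Qed.

Definition set_coord x j (t : R) : 'rV[R]_d := \row_i (if i == j then t else x ord0 i).

Lemma set_coord_id x j : set_coord x j (x ord0 j) = x.
Proof. by apply/rowP => i; rewrite mxE; case: eqP => // ->. Qed.

Lemma set_coordD x j s t : set_coord x j (s + t) = s *: @evec R d j + set_coord x j t.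
Proof.
by apply/rowP => i; rewrite !mxE eqxx /=; case: eqP; rewrite ?mulr1 ?mulr0 ?add0r.
Qed.

Lemma open_cube_set_coord x j t : open_cube x -> 0 < t < 1 -> open_cube (set_coord x j t).
Proof. by move=> ox t01 i; rewrite mxE; case: eqP. Qed.

Lemma is_derive_set_coord f x j t : derivable f (set_coord x j t) (@evec R d j) ->
  is_derive t 1 (f \o set_coord x j) ('D_(@evec R d j) f (set_coord x j t)).
Proof.
pose y := set_coord x j t.
have quotE : (fun h : R => h^-1 *: (((f \o set_coord x j) \o shift t) (h *: (1 : R)) - f y))
    = (fun h => h^-1 *: ((f \o shift y) (h *: @evec R d j) - f y)).
  by apply/funext => h /=; rewrite [_ *: 1]mulr1 set_coordD.
by move=> df; split; [rewrite /derivable quotE|rewrite /derive quotE].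
Qed.

Lemma dalpha_pure f j m :
  dalpha (fun i => if i == j then m else 0%N) f = dpart (nseq m j) f.
Proof.
rewrite /dalpha; congr (dpart _ f).
suff flatten_nseq s : uniq s -> flatten [seq nseq (if i == j then m else 0%N) i | i <- s] =
    (if j \in s then nseq m j else [::]).
  by rewrite flatten_nseq ?enum_uniq // mem_enum.
elim: s => //= a s ih /andP[as_ us]; rewrite ih // inE (eq_sym j).
by case: (eqVneq a j) as_ => [->|] //= /negbTE ->; rewrite cats0.
Qed.

Lemma dalpha0 f : dalpha (fun=> 0%N) f = f.
Proof.
by rewrite /dalpha (_ : flatten _ = [::]) //; elim: (enum _).
Qed.

Section pure_derivatives.
Variables (m : nat) (B : R) (f : 'rV[R]_d -> R).
Hypothesis Ff : Fclass m B f.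

Lemma Fclass_le_open_cube x : open_cube x -> `|f x| <= B.
Proof.
move=> ox; have [_ /(_ (fun=> 0%N))] := Ff; rewrite dalpha0; apply.
  by rewrite big1.
exact: open_cube_sub_interior.
Qed.

Lemma dpart_nseq_le j x : open_cube x -> `|dpart (nseq m j) f x| <= B.
Proof.
move=> ox; rewrite -dalpha_pure; have [_] := Ff; apply.
  by rewrite -big_mkcond /= big_pred1_eq.
exact: open_cube_sub_interior.
Qed.

Lemma is_derive_dpart_nseq j k x (t : R) : (k < m)%N -> open_cube x -> 0 < t < 1 ->
  is_derive t 1 (dpart (nseq k j) f \o set_coord x j)
    (dpart (nseq k.+1 j) f (set_coord x j t)).
Proof.
move=> km ox t01; apply: is_derive_set_coord; have [[_ df _] _] := Ff.
by apply: df; rewrite ?size_nseq //; exact/open_cube_sub_interior/open_cube_set_coord.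
Qed.

End pure_derivatives.

Definition node (P l : nat) : R := (l%:R + 2^-1) / P%:R.

Lemma node_gt0_lt1 P l : (l < P)%N -> 0 < node P l < 1.
Proof.
move=> lP; have P0 : 0 < P%:R :> R by rewrite ltr0n; lia.
have : l.+1%:R <= P%:R :> R by rewrite ler_nat.
rewrite /node divr_gt0 //= ?ltr_pdivrMr ?mul1r //.
by rewrite -natr1; lra.
Qed.

Lemma nodeS P l : node P l.+1 = node P l + P%:R^-1.
Proof. by rewrite /node -natr1; ring. Qed.

Definition cell (N l : nat) : set R :=
  `]0, 1[%classic `&` `[l%:R / N%:R, l.+1%:R / N%:R]%classic.

Lemma is_interval_cell N l : is_interval (cell N l).
Proof.
move=> u v [u1 u2] [v1 v2] z uzv.
by split; [apply: interval_is_interval uzv|apply: interval_is_interval uzv].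
Qed.

Lemma cell_diameter N l u v : (0 < N)%N -> cell N l u -> cell N l v ->
  `|u - v| <= N%:R^-1.
Proof.
move=> N0 [_ /=]; rewrite in_itv /= => /andP[u0 u1] [_ /=].
rewrite in_itv /= => /andP[v0 v1].
have : l.+1%:R / N%:R = l%:R / N%:R + N%:R^-1 :> R by rewrite -natr1 mulrDl mul1r.
by rewrite ler_norml; lra.
Qed.

Lemma mem_some_cell N t : (0 < N)%N -> 0 < t < 1 ->
  exists2 l, (l < N)%N & cell N l t.
Proof.
move=> N0 /andP[t0 t1]; have NR0 : 0 < N%:R :> R by rewrite ltr0n.
have /andP[lt tl] : (Num.truncn (t * N%:R))%:R <= t * N%:R < (Num.truncn (t * N%:R)).+1%:R.
  by apply: truncn_itv; rewrite mulr_ge0 // ltW.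
exists (Num.truncn (t * N%:R)); last first.
  by split; rewrite /= in_itv /= ?t0 // ler_pdivrMr // ler_pdivlMr // lt ltW.
by rewrite -(ltr_nat R) (le_lt_trans lt) // -[ltRHS]mul1r ltr_pM2r.
Qed.

Lemma cell_node N K l r : (l < N)%N -> (r < K)%N ->
  cell N l (node (N * K) (l * K + r)).
Proof.
move=> lN rK; have [N0 K0] : (0 < N)%N /\ (0 < K)%N by lia.
have P0 : 0 < (N * K)%:R :> R by rewrite ltr0n muln_gt0 N0.
split; rewrite /= in_itv /=; first by apply: node_gt0_lt1; nia.
have divE a : a%:R / N%:R = (a * K)%:R / (N * K)%:R :> R.
  by rewrite !natrM -mulf_div divff ?mulr1 // gt_eqF // ltr0n.
have : (l * K + r).+1%:R <= (l.+1 * K)%:R :> R by rewrite ler_nat; nia.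
rewrite !divE /node !ler_pM2r ?invr_gt0 // -natr1 natrD.
by have := ler0n R r; lra.
Qed.

Section agreement_on_grid.
Variables (m : nat) (B : R) (f g : 'rV[R]_d -> R).
Hypotheses (Ff : Fclass m B f) (Fg : Fclass m B g).

Definition line_stability : R := geom_sum (2 * 2 ^+ m) m.

Lemma line_stability_ge0 : 0 <= line_stability.
Proof. by rewrite geom_sum_ge0 // mulr_ge0 // exprn_ge0. Qed.

Lemma close_of_close_at_nodes (N : nat) x j (e : R) :
  (0 < N)%N -> 0 <= e -> open_cube x ->
  (forall l, (l < N * 2 ^ m)%N ->
    `|f (set_coord x j (node (N * 2 ^ m) l)) - g (set_coord x j (node (N * 2 ^ m) l))| <= e) ->
  `|f x - g x| <= line_stability * e + 2 * B * N%:R^-1 ^+ m.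
Proof.
move=> N0 e0 ox hx; have [l lN cl] := mem_some_cell N0 (ox j).
pose phi k t := dpart (nseq k j) f (set_coord x j t) - dpart (nseq k j) g (set_coord x j t).
have -> : f x - g x = phi 0%N (x ord0 j) by rewrite /phi /= set_coord_id.
have NR0 : 0 < N%:R :> R by rewrite ltr0n.
have K0 : 0 < 2 ^+ m :> R by rewrite exprn_gt0.
apply: (@small_of_small_at_separated_nodes _ _ phi
  (fun r => node (N * 2 ^ m) (l * 2 ^ m + r)) _ _ (N * 2 ^ m)%:R^-1 _ _ _
  (@is_interval_cell N l)) => //.
- by rewrite invr_gt0 natrM natrX mulr_gt0.
- by rewrite natrM natrX invfM mulrCA divff ?mulr1 // gt_eqF.
- by move=> u v; exact: cell_diameter.
- move=> k z km [/= z01 _]; rewrite in_itv /= in z01.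
  have df := is_derive_dpart_nseq Ff j km ox z01.
  have dg := is_derive_dpart_nseq Fg j km ox z01.
  exact: is_deriveB.
- move=> z [/= z01 _]; rewrite in_itv /= in z01; have oz := open_cube_set_coord j ox z01.
  rewrite (le_trans (ler_normB _ _)) //.
  by have := dpart_nseq_le Ff j oz; have := dpart_nseq_le Fg j oz; lra.
- split=> [r rK|r _]; last by rewrite addnS nodeS.
  by split; [exact: cell_node|apply: hx; nia].
Qed.

Definition grid (P : nat) : seq 'rV[R]_d :=
  [seq \row_i node P (v i) | v : {ffun 'I_d -> 'I_P}].

Lemma mem_grid P x :
  (forall i, exists2 l, (l < P)%N & x ord0 i = node P l) -> x \in grid P.
Proof.
move=> hx; have /choice[v hv] i : exists l : 'I_P, x ord0 i = node P l.
  by have [l lP xl] := hx i; exists (Ordinal lP).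
apply/mapP; exists [ffun i => v i]; first by rewrite mem_enum.
by apply/rowP => i; rewrite mxE ffunE hv.
Qed.

Lemma close_of_eq_on_grid (N : nat) x : (0 < N)%N -> open_cube x ->
  {in grid (N * 2 ^ m), f =1 g} ->
  `|f x - g x| <= geom_sum line_stability d * (2 * B * N%:R^-1 ^+ m).
Proof.
move=> N0 + fg; set P := (N * 2 ^ m)%N in fg *.
(* Only the first k coordinates of x are off the grid. *)
suff close k : (k <= d)%N -> forall x, open_cube x ->
    (forall i, (k <= i)%N -> exists2 l, (l < P)%N & x ord0 i = node P l) ->
    `|f x - g x| <= geom_sum line_stability k * (2 * B * N%:R^-1 ^+ m).
  by move=> ox; apply: close => // i; have := ltn_ord i; lia.
elim: k => [_|k ih kd] {}x ox hx.
  rewrite fg ?subrr ?normr0 ?geom_sum0 ?mul0r //.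
  by apply: mem_grid => i; exact: hx.
have B0 : 0 <= B := le_trans (normr_ge0 _) (Fclass_le_open_cube Ff ox).
rewrite geom_sumS mulrDl mul1r [leRHS]addrC -mulrA.
apply: (close_of_close_at_nodes (j := Ordinal kd)) => //.
  by rewrite mulr_ge0 ?geom_sum_ge0 ?line_stability_ge0 // !mulr_ge0 // exprn_ge0 // invr_ge0.
move=> l lP; apply: ih; [exact: ltnW|exact/open_cube_set_coord/node_gt0_lt1|] => i ki.
rewrite mxE; case: eqVneq => [_|ij]; first by exists l.
apply: hx; rewrite ltn_neqAle ki andbT; apply: contra ij => /eqP ki'.
by apply/eqP/val_inj.
Qed.

End agreement_on_grid.

End grid.

Section row_vectors.
Context (R : realType) (d : nat).
Implicit Types (x : 'rV[R]_d) (i j : 'I_d).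

Lemma continuous_rV (T : topologicalType) (h : T -> 'rV[R]_d) :
  (forall i, continuous (fun t => h t ord0 i)) -> continuous h.
Proof.
move=> ch t A [P nP sPA]; apply: (@filterS _ (nbhs t) _ _ _
  (fun u hu => sPA (h u) (fun k i => hu i k))).
apply: (@filter_forall _ _ (fun i u => forall k, P k i (h u k i) : Prop) _
  (@nbhs_filter _ t)) => i.
apply: (@filterS _ (nbhs t) _ _ _ _ (ch i t _ (nP ord0 i))) => u Pu k.
by rewrite (ord1 k).
Qed.

Lemma measurable_coord i : measurable_fun setT (fun x => x ord0 i : R).
Proof.
move=> _ Y mY; rewrite setTI; apply: sub_sigma_algebra.
rewrite -bigcup_seq /=; exists i; first by rewrite /= mem_index_enum.
by exists Y; rewrite ?setTI.
Qed.

Lemma measurable_rV (dT : measure_display) (T : measurableType dT) (h : T -> 'rV[R]_d) :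
  (forall i, measurable_fun setT (fun t => h t ord0 i)) -> measurable_fun setT h.
Proof.
move=> mh; pose coor i x : R := x ord0 i.
apply: (@measurability _ _ _ _ _ _
  (\big[setU/set0]_(i < d) preimage_set_system setT (coor i) measurable)) => //.
move=> _ [A + <-]; rewrite -bigcup_seq /= => -[i _ [Y mY <-]].
by have := mh i measurableT Y mY; rewrite !setTI.
Qed.

Definition rational_box (q : 'rV[rat]_d * nat) : set 'rV[R]_d :=
  [set x | forall i, `|ratr (q.1 ord0 i) - x ord0 i| < q.2.+1%:R^-1].

Lemma measurable_rational_box q : measurable (rational_box q).
Proof.
have -> : rational_box q = \bigcap_(i in [set: 'I_d])
    [set x | `|ratr (q.1 ord0 i) - x ord0 i| < q.2.+1%:R^-1].
  by apply/seteqP; split => [x xq i _|x xq i]; [exact: xq|exact: (xq i)].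
apply: fin_bigcap_measurable => // i _; rewrite -[X in measurable X]setTI.
have mdist : measurable_fun setT (fun x => `|ratr (q.1 ord0 i) - x ord0 i| < q.2.+1%:R^-1).
  apply: measurable_fun_ltr => //; apply: measurableT_comp => //.
  by apply: measurable_funB => //; exact: measurable_coord.
exact: (mdist measurableT [set true]).
Qed.

Lemma nbhs_rational_box x (U : set 'rV[R]_d) : nbhs x U ->
  exists2 q, rational_box q x & rational_box q `<=` U.
Proof.
move=> /nbhs_ballP[e /= e0 xeU].
have [n ne] : exists n, n.+1%:R^-1 < e / 2.
  have [n _ /(_ n (leqnn n))] :=
    @near_infty_natSinv_lt R (PosNum (divr_gt0 e0 (ltr0n R 2))).
  by exists n.
have n0 : 0 < n.+1%:R^-1 :> R by rewrite invr_gt0.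
have /choice[q hq] i : exists q : rat, `|ratr q - x ord0 i| < n.+1%:R^-1.
  have [|q /[!in_itv]/= /andP[xq qx]] :=
    @rat_in_itvoo R (x ord0 i) (x ord0 i + n.+1%:R^-1); first by rewrite ltrDl.
  by exists q; rewrite gtr0_norm ?subr_gt0 // ltrBlDl.
exists (\row_i q i, n) => [i|y qy]; first by rewrite /= mxE.
apply: xeU; split => // i j; rewrite (ord1 i) -ball_normE /ball_ /=.
have := hq j; have := qy j; move: ne; rewrite /= mxE.
by move: (n.+1%:R^-1) => t; rewrite !ltr_norml; lra.
Qed.

Lemma open_measurable_rV (U : set 'rV[R]_d) : open U -> measurable U.
Proof.
move=> oU.
have -> : U = \bigcup_(q in [set q | rational_box q `<=` U]) rational_box q.
  apply/seteqP; split => [x Ux|x [q qU]]; last exact: qU.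
  by have [q xq qU] := nbhs_rational_box (open_nbhs_nbhs (conj oU Ux)); exists q.
rewrite bigcup_mkcond; apply: countable_bigcupT_measurable => [|q].
  exact: countableP.
by case: ifP => // _; exact: measurable_rational_box.
Qed.

Lemma continuous_measurable_rV (g : 'rV[R]_d -> R) :
  continuous g -> measurable_fun setT g.
Proof.
move=> /continuousP cg.
apply: (measurability _ (RGenOpens.measurableE R)) => _ [_ [a [b ->] <-]].
by rewrite setTI; apply: open_measurable_rV; apply: cg; exact: interval_open.
Qed.

End row_vectors.

Lemma le_closure (R : realType) (T : topologicalType) (g : T -> R) (c : R) (A : set T) :
  continuous g -> (forall x, A x -> g x <= c) -> forall x, closure A x -> g x <= c.
Proof.
move=> cg Ac x; have le_closed : closed [set y | g y <= c].
  by apply: (@preimage_closed _ _ g [set t | t <= c]) => [y _|]; [exact: cg|exact: closed_le].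
have := @closure_subset _ A [set y | g y <= c] Ac x.
by rewrite -((closure_id _).1 le_closed).
Qed.

Lemma continuous_norm_comp (R : realType) (T : topologicalType) (h : T -> R) :
  continuous h -> continuous (fun x => `|h x|).
Proof. by move=> ch x; exact: (continuous_comp (ch x) (@norm_continuous _ _ _)). Qed.

Section clip.
Context (R : realType) (d : nat).
Implicit Types x : 'rV[R]_d.

Definition clip x : 'rV[R]_d := \row_i Num.max 0 (Num.min 1 (x ord0 i)).

Lemma clip_cube x : @cube R d (clip x).
Proof. by move=> i; rewrite mxE le_max lexx /= ge_max ler01 /= ge_min lexx. Qed.

Lemma clip_id x : @cube R d x -> clip x = x.
Proof.
move=> cx; apply/rowP => i; rewrite mxE; have /andP[x0 x1] := cx i.
by rewrite (min_idPr x1) (max_idPr x0).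
Qed.

Lemma clip_continuous : continuous clip.
Proof.
apply: continuous_rV => i.
rewrite (_ : (fun _ => _) = cst 0 \max (cst 1 \min (fun x => x ord0 i))); last first.
  by apply/funext => x; rewrite mxE.
move=> x; apply: continuous_max; first exact: cst_continuous.
by apply: continuous_min; [exact: cst_continuous|exact: coord_continuous].
Qed.

Lemma measurable_clip : measurable_fun setT clip.
Proof.
apply: measurable_rV => i; apply: continuous_measurable_rV => x.
apply: (@continuous_comp _ _ _ clip (fun y : 'rV[R]_d => y ord0 i)).
  exact: clip_continuous.
exact: coord_continuous.
Qed.

Lemma clip_continuous_comp (f : 'rV[R]_d -> R) :
  {within @cube R d, continuous f} -> continuous (f \o clip).
Proof.
move=> /subspace_continuousP cf x.
apply: (cvg_comp _ _ _ (cf _ (clip_cube x))) => U /= nU.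
apply: (@filterS _ (nbhs x) _ _ _ _ (clip_continuous nU)) => y /=.
by apply; exact: clip_cube.
Qed.

Lemma cube_sub_closure_open_cube : @cube R d `<=` closure (@open_cube R d).
Proof.
move=> x cx A /nbhs_ballP[r /= r0 xrA].
pose s := Num.min 2^-1 (r / 2) : R.
have s0 : 0 < s by rewrite lt_min divr_gt0 // invr_gt0 ltr0n.
have s2 : s <= 2^-1 by rewrite ge_min lexx.
have sr : s <= r / 2 by rewrite ge_min lexx orbT.
exists (\row_i ((1 - s) * x ord0 i + s / 2)); split.
  by move=> i; rewrite mxE; have /andP[x0 x1] := cx i; apply/andP; split; nra.
apply: xrA; split => // i j; rewrite !ord1 -ball_normE /ball_ /= mxE.
by have /andP[x0 x1] := cx j; rewrite ltr_norml; apply/andP; split; nra.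
Qed.

Lemma le_clip_of_open_cube (g : 'rV[R]_d -> R) (c : R) : continuous (g \o clip) ->
  (forall x, open_cube x -> g x <= c) -> forall x, g (clip x) <= c.
Proof.
move=> cg gc x; rewrite -[clip x](clip_id (clip_cube x)).
apply: (le_closure (A := @open_cube R d) cg) => [y oy|].
  by rewrite /= clip_id; [exact: gc|exact: open_cube_sub_cube].
exact/cube_sub_closure_open_cube/clip_cube.
Qed.

End clip.

Section class_on_cube.
Context (R : realType) (d m : nat) (B : R).
Implicit Types f g : 'rV[R]_d -> R.

Lemma Fclass_continuous_clip f : Fclass m B f -> continuous (f \o @clip R d).
Proof. by move=> [[cf _ _] _]; exact: clip_continuous_comp. Qed.

Lemma Fclass_measurable_clip f : Fclass m B f -> measurable_fun setT (f \o @clip R d).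
Proof. by move=> /Fclass_continuous_clip; exact: continuous_measurable_rV. Qed.

Lemma Fclass_le f : Fclass m B f -> forall x, `|f (clip x)| <= B.
Proof.
move=> Ff; apply: (le_clip_of_open_cube (g := fun x => `|f x|)) => [|x].
  exact: (continuous_norm_comp (Fclass_continuous_clip Ff)).
exact: (Fclass_le_open_cube Ff).
Qed.

Lemma close_on_cube_of_eq_on_grid f g (N : nat) : (0 < N)%N ->
  Fclass m B f -> Fclass m B g -> {in @grid R d (N * 2 ^ m), f =1 g} ->
  forall x, `|f (clip x) - g (clip x)| <=
    geom_sum (line_stability R m) d * (2 * B * N%:R^-1 ^+ m).
Proof.
move=> N0 Ff Fg fg; apply: (le_clip_of_open_cube (g := fun x => `|f x - g x|)) => [|x ox].
  apply: (continuous_norm_comp (h := (f \o @clip R d) \- (g \o @clip R d))) => x.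
  exact: (continuousB (@Fclass_continuous_clip _ Ff x) (@Fclass_continuous_clip _ Fg x)).
exact: close_of_eq_on_grid.
Qed.

End class_on_cube.

Section grid_size.
Context (R : realType) (d m : nat).
Hypothesis d_gt0 : (0 < d)%N.

Lemma size_grid P : size (@grid R d P) = (P ^ d)%N.
Proof. by rewrite size_map -cardE card_ffun !card_ord. Qed.

Lemma grid_in_cube P : {in @grid R d P, forall x, @cube R d x}.
Proof.
move=> _ /mapP[v _ ->]; apply: open_cube_sub_cube => i.
by rewrite mxE; exact: node_gt0_lt1.
Qed.

Lemma max_grid_size (K p : nat) : (0 < K)%N ->
  exists N, ((N * K) ^ d <= p < (N.+1 * K) ^ d)%N.
Proof.
move=> K0.
have ex : exists N, ((N * K) ^ d <= p)%N by exists 0%N; rewrite mul0n exp0n.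
have ub N : ((N * K) ^ d <= p)%N -> (N <= p)%N.
  apply: leq_trans; rewrite (@leq_trans (N * K)) ?leq_pmulr //.
  case: (posnP (N * K)) => [->//|NK0]; rewrite -[X in (X <= _)%N]expn1.
  by rewrite leq_pexp2l.
case: (ex_maxnP ex ub) => N hN mx; exists N; rewrite hN /=.
by rewrite ltnNge; apply/negP => /mx; rewrite ltnn.
Qed.

Lemma inv_expr_le_rate (K N n : nat) : (0 < N)%N -> (0 < n)%N ->
  (n <= (N * K) ^ d)%N ->
  N%:R^-1 ^+ m <= K%:R ^+ m * n%:R `^ (- (m%:R / d%:R)) :> R.
Proof.
move=> N0 n0 nle.
have nd : n%:R `^ (m%:R / d%:R) <= (N%:R * K%:R) ^+ m :> R.
  have -> : (N%:R * K%:R) ^+ m = ((N%:R * K%:R) ^+ d) `^ (m%:R / d%:R) :> R.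
    rewrite -!powR_mulrn ?mulr_ge0 // -powRrM; congr (_ `^ _).
    by rewrite mulrC divfK // pnatr_eq0 -lt0n.
  apply: ge0_ler_powR; rewrite ?divr_ge0 // ?nnegrE ?exprn_ge0 ?mulr_ge0 //.
  by rewrite -natrM -natrX ler_nat.
rewrite powRN ler_pdivlMr ?powR_gt0 ?ltr0n // exprVn mulrC.
by rewrite ler_pdivrMr ?exprn_gt0 ?ltr0n // -exprMn (mulrC K%:R).
Qed.

(* Half of the evaluations go to the grid; if they are too few for one grid of 2^m
   points per axis, the rate is of order 1 and the a priori bound suffices. *)
Lemma grid_approximation : exists2 c : R, 0 < c &
  forall n, (0 < n)%N -> exists G : seq 'rV[R]_d, [/\ (size G <= n./2)%N,
    {in G, forall x, @cube R d x} &
    forall (B : R) f g, Fclass m B f -> Fclass m B g -> {in G, f =1 g} ->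
    forall x, `|f (clip x) - g (clip x)| <= c * (B * n%:R `^ (- (m%:R / d%:R)))].
Proof.
pose a : R := geom_sum (line_stability R m) d.
have a0 : 0 <= a by rewrite geom_sum_ge0 // line_stability_ge0.
pose K := (2 ^ m)%N; have K0 : (0 < K)%N by rewrite expn_gt0.
exists ((a + 1) * 2 * (4 * K)%:R ^+ m) => [|n n0].
  by rewrite mulr_gt0 ?exprn_gt0 ?mulr_gt0 ?ltr0n ?muln_gt0 // ltr_wpDl.
have [N /andP[sizeN nN]] := max_grid_size n./2 K0.
exists (grid R d (N * K)); split; [by rewrite size_grid|exact: grid_in_cube|].
move=> B f g Ff Fg fg x; have B0 : 0 <= B := le_trans (normr_ge0 _) (Fclass_le Ff x).
have dist : `|f (clip x) - g (clip x)| <= (a + 1) * (2 * B * (maxn 1 N)%:R^-1 ^+ m).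
  have [N0|N0] := posnP N.
    rewrite N0 (_ : maxn 1 0 = 1%N) // invr1 expr1n mulr1 (le_trans (ler_normB _ _)) //.
    by have := Fclass_le Ff x; have := Fclass_le Fg x; nra.
  rewrite (maxn_idPr N0) (le_trans (close_on_cube_of_eq_on_grid N0 Ff Fg fg x)) //.
  by rewrite ler_wpM2r ?lerDl // !mulr_ge0 // exprn_ge0 // invr_ge0.
have rate : (maxn 1 N)%:R^-1 ^+ m <= (4 * K)%:R ^+ m * n%:R `^ (- (m%:R / d%:R)) :> R.
  apply: inv_expr_le_rate; rewrite ?leq_max //.
  have d2 : (2 <= 2 ^ d)%N by rewrite -[X in (X <= _)%N]expn1 leq_pexp2l.
  apply: (@leq_trans (2 ^ d * (N.+1 * K) ^ d)); last by rewrite -expnMn leq_exp2r //; nia.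
  by apply: leq_trans (leq_mul d2 nN); have := odd_double_half n; case: (odd n) => /=; lia.
apply: le_trans dist _; rewrite -2![leRHS]mulrA ler_wpM2l ?addr_ge0 //.
by rewrite -mulrA ler_wpM2l // [leRHS]mulrCA ler_wpM2l.
Qed.

End grid_size.

(** * The uniform distribution on the cube *)

Section cube_prob.
Context (R : realType).
Local Open Scope ereal_scope.
Implicit Types (n : nat) (x : R).

Definition unit_uniform : probability (measurableTypeR R) R := uniform_prob (@ltr01 R).

Lemma integral_unit_uniform (h : R -> \bar R) :
  measurable_fun setT h -> (forall x, 0 <= h x) ->
  \int[unit_uniform]_x h x = \int[lebesgue_measure]_(x in `[0%R, 1%R]) h x.
Proof. by move=> mh h0; rewrite integral_uniform // subr0 invr1 mul1e. Qed.

Definition vcons n (xv : measurableTypeR R * 'rV[R]_n) : 'rV[R]_n.+1 :=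
  \row_i (if unlift ord0 i is Some j then xv.2 ord0 j else xv.1).

Lemma measurable_vcons n : measurable_fun setT (@vcons n).
Proof.
apply: measurable_rV => i; case: (unliftP ord0 i) => [j|] ->.
  rewrite (_ : (fun _ => _) = (fun v : 'rV[R]_n => v ord0 j) \o snd).
    by apply: measurableT_comp => //; exact: measurable_coord.
  by apply/funext => xv; rewrite mxE liftK.
by rewrite (_ : (fun _ => _) = fst) //; apply/funext => xv; rewrite mxE unlift_none.
Qed.

HB.instance Definition _ n := isMeasurableFun.Build _ _ _ _ _ (@measurable_vcons n).

Lemma measurable_vcons_pair n x : measurable_fun setT (fun v : 'rV[R]_n => vcons (x, v)).
Proof.
have mpair : measurable_fun setT (pair x : 'rV[R]_n -> measurableTypeR R * 'rV[R]_n).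
  exact: pair1_measurable.
exact: (measurableT_comp (@measurable_vcons n) mpair).
Qed.

Lemma row_tnth_cons n x (t : n.-tuple R) :
  \row_i tnth (cons_tuple x t) i = vcons (x, \row_i tnth t i).
Proof.
apply/rowP => i; rewrite !mxE; case: unliftP => [j|] -> /=; last by rewrite (tnth_nth x).
by rewrite mxE !(tnth_nth x).
Qed.


Lemma leb_intS n (g : 'rV[R]_n.+1 -> \bar R) :
  leb_int g = \int[@lebesgue_measure R]_x leb_int (fun v => g (vcons (x, v))).
Proof.
apply: eq_integral => x _; rewrite /leb_int; congr (lebI _).
by apply/funext => t; rewrite row_tnth_cons.
Qed.

Lemma leb_int0 n : leb_int (fun _ : 'rV[R]_n => 0) = 0.
Proof.
rewrite /leb_int; elim: n => //= n ih.
by rewrite (eq_integral (cst 0)) ?integral0 // => x _; rewrite ih.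
Qed.

Fixpoint cube_prob n : probability 'rV[R]_n R :=
  if n is n'.+1 then distribution (unit_uniform \x cube_prob n') (@vcons n')
  else \d_ (0%R : 'rV[R]_0).

Lemma cube_vcons n x (v : 'rV[R]_n) :
  @cube R n.+1 (vcons (x, v)) <-> `[0%R, 1%R]%classic x /\ @cube R n v.
Proof.
rewrite /= in_itv /=; split => [cxv|[x01 cv] i].
  split; first by have := cxv ord0; rewrite mxE unlift_none.
  by move=> i; have := cxv (lift ord0 i); rewrite mxE liftK.
by rewrite mxE; case: unliftP.
Qed.

Lemma integral_cube_probS n (g : 'rV[R]_n.+1 -> \bar R) :
  measurable_fun setT g -> (forall v, 0 <= g v) ->
  \int[cube_prob n.+1]_v g v =
  \int[lebesgue_measure]_(x in `[0%R, 1%R]) \int[cube_prob n]_v g (vcons (x, v)).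
Proof.
move=> mg g0; have mgv : measurable_fun setT (g \o @vcons n).
  by apply: measurableT_comp => //; exact: measurable_vcons.
rewrite ge0_integral_distribution // fubini_tonelli1 //; last by move=> xv; exact: g0.
apply: integral_unit_uniform => [|x].
  exact: (measurable_fun_fubini_tonelli_F _ mgv (fun xv => g0 _)).
by apply: integral_ge0 => v _; exact: g0.
Qed.

Lemma integral_cube_prob n (g : 'rV[R]_n -> \bar R) :
  measurable_fun setT g -> (forall v, 0 <= g v) ->
  \int[cube_prob n]_v g v = leb_int (fun v => (\1_(@cube R n) v)%:E * g v).
Proof.
elim: n g => [|n ih] g mg g0.
  rewrite integral_dirac // diracT mul1e /leb_int /= indicE mem_set ?mul1e //; last by case.
  by congr g; apply/rowP => -[].
rewrite integral_cube_probS // leb_intS integral_mkcond; apply: eq_integral => x _.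
rewrite patchE; case: ifPn => [x01|xn01]; last first.
  rewrite -[LHS](leb_int0 n); congr leb_int; apply/funext => v.
  rewrite indicE memNset ?mul0e // => /cube_vcons[x01 _].
  by move/negP: xn01; apply; rewrite inE.
have mgx : measurable_fun setT (fun v => g (vcons (x, v))).
  exact: (measurableT_comp mg (measurable_vcons_pair x)).
rewrite ih //; congr leb_int; apply/funext => v; congr (_%:E * _).
rewrite !indicE; congr (_%:R); congr nat_of_bool; apply/idP/idP; rewrite !inE.
  by move=> cv; apply/cube_vcons; split=> //; exact: set_mem x01.
by move=> /cube_vcons[].
Qed.

End cube_prob.

Section densities.
Context (R : realType).
Local Open Scope ereal_scope.

Section has_density.
Context d1 d2 (T : measurableType d1) (U : measurableType d2).
Variables (P : {measure set T -> \bar R}) (mu : {measure set U -> \bar R}).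

Definition has_density (X : T -> U) (rho : U -> R) :=
  [/\ measurable_fun setT X, measurable_fun setT rho, (forall y, 0 <= rho y)%R &
    forall g : U -> \bar R, measurable_fun setT g -> (forall y, 0 <= g y) ->
      \int[P]_w g (X w) = \int[mu]_y (g y * (rho y)%:E)].

End has_density.

Lemma has_density_id d (T : measurableType d) (P : {measure set T -> \bar R}) :
  has_density P P idfun (cst 1%R).
Proof.
split=> // [|g mg g0]; first exact: measurable_id.
by apply: eq_integral => w _; rewrite mule1.
Qed.

Lemma has_density_comp d1 d2 d3 (T : measurableType d1) (U : measurableType d2)
    (V : measurableType d3) (P : {measure set T -> \bar R})
    (mu : {measure set U -> \bar R}) (nu : {measure set V -> \bar R})
    (X : T -> U) (Y : U -> V) (sigma rho : V -> R) :
  has_density P mu X (sigma \o Y) -> has_density mu nu Y rho ->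
  measurable_fun setT sigma -> (forall y, 0 <= sigma y)%R ->
  has_density P nu (Y \o X) (fun y => sigma y * rho y)%R.
Proof.
move=> [mX _ _ densX] [mY mrho rho0 densY] msigma sigma0.
split; first exact: measurableT_comp.
- exact: measurable_funM.
- by move=> y; rewrite mulr_ge0.
move=> g mg g0; rewrite (densX (g \o Y)); [|exact: measurableT_comp|by move=> u; exact: g0].
rewrite (densY (fun y => g y * (sigma y)%:E)).
- by apply: eq_integral => y _; rewrite -muleA -EFinM.
- by apply: emeasurable_funM => //; exact/measurable_EFinP.
- by move=> y; rewrite mule_ge0 ?lee_fin.
Qed.

Lemma has_density_clip d : has_density (cube_prob R d) (cube_prob R d) (@clip R d) (cst 1%R).
Proof.
split=> // [|g mg g0]; first exact: measurable_clip.
have mgc : measurable_fun setT (g \o @clip R d).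
  by apply: measurableT_comp mg _; exact: measurable_clip.
rewrite !integral_cube_prob //; last 2 first.
- by under eq_fun do rewrite mule1.
- by move=> v; rewrite mule1.
congr leb_int; apply/funext => v; rewrite indicE mule1.
by case: (boolP (v \in _)) => [|_]; rewrite ?mul0e // inE => /clip_id ->.
Qed.

End densities.

Section probability_integrals.
Context d (T : measurableType d) (R : realType) (P : probability T R).
Local Open Scope ereal_scope.

Lemma integral_prob_cst (r : \bar R) : \int[P]_w r = r.
Proof. by rewrite integral_cst // [X in _ * X]probability_setT mule1. Qed.

Lemma integral_prob_bounds (a : T -> R) (l u : R) : measurable_fun setT a ->
  (0 <= l)%R -> (forall w, l <= a w <= u)%R ->
  l%:E <= \int[P]_w (a w)%:E <= u%:E.
Proof.
move=> ma l0 alu; have la w : (l <= a w)%R by have /andP[] := alu w.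
have au w : (a w <= u)%R by have /andP[] := alu w.
have a0 w : (0 <= a w)%R by exact: le_trans l0 _.
have ma' : measurable_fun setT (fun w => (a w)%:E) by exact/measurable_EFinP.
rewrite -[l%:E]integral_prob_cst -[u%:E]integral_prob_cst.
by apply/andP; split; apply: ge0_le_integral => // w _; rewrite ?lee_fin.
Qed.

End probability_integrals.

(** * Rejection sampling *)

Section unit_uniform_threshold.
Context (R : realType) (c : R).
Hypothesis c01 : 0 <= c <= 1.
Local Open Scope ereal_scope.

Lemma unit_uniform_itvNyc : unit_uniform R `]-oo, c]%classic = c%:E.
Proof.
have /andP[c0 c1] := c01; rewrite [LHS]integral_uniform_pdf.
have -> : `]-oo, c]%classic `&` `[0%R, 1%R]%classic = `[0%R, c]%classic.
  apply/seteqP; split => x /=; rewrite !in_itv /=; first by case=> -> /andP[->].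
  by move=> /andP[-> xc]; rewrite xc (le_trans xc).
rewrite (eq_integral (cst 1)) => [|x].
  rewrite integral_cst // mul1e [LHS]lebesgue_measure_itv /= lte_fin.
  by case: ltgtP c0 => //= [_ _|<- _]; rewrite ?oppr0 ?adde0.
rewrite inE /= in_itv /uniform_pdf /= subr0 invr1 => /andP[-> xc].
by rewrite (le_trans xc c1).
Qed.

Lemma integral_unit_uniform_if (A B : \bar R) : 0 <= A -> 0 <= B ->
  \int[unit_uniform R]_t (if (t <= c)%R then A else B) = A * c%:E + B * (1 - c)%:E.
Proof.
move=> A0 B0; pose below : set (measurableTypeR R) := `]-oo, c]%classic.
have mbelow : measurable below by exact: measurable_itv.
have aboveE : unit_uniform R (~` below) = (1 - c)%:E.
  by rewrite probability_setC // unit_uniform_itvNyc EFinB.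
rewrite -(setUv below) ge0_integral_setU //.
- rewrite (eq_integral (cst A)); last by move=> t; rewrite inE /below /= in_itv /= => ->.
  rewrite [X in _ + X](eq_integral (cst B)); last first.
    by move=> t; rewrite inE /below /= in_itv /= => /negP/negbTE ->.
  rewrite !integral_cst //; last exact: measurableC.
  by rewrite -aboveE -unit_uniform_itvNyc.
- exact: measurableC.
- rewrite setUv; apply: measurable_fun_ifT => //; exact: measurable_fun_ler.
- by move=> t _; case: ifP.
- exact/disj_setPCl.
Qed.

End unit_uniform_threshold.

Section rejection_weight.
Context (R : numDomainType).
Implicit Types (q a : R) (k : nat).

(* The relative density of the output of k rejection trials at a point accepted with
   probability a, when a trial rejects with probability q. *)
Definition rejection_weight q k a : R := geom_sum q k * a + q ^+ k.

Lemma rejection_weight0 q a : rejection_weight q 0 a = 1.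
Proof. by rewrite /rejection_weight geom_sum0 mul0r add0r expr0. Qed.

Lemma rejection_weightS q k a :
  rejection_weight q k.+1 a = a + q * rejection_weight q k a.
Proof. by rewrite /rejection_weight geom_sumS exprS; ring. Qed.

Lemma rejection_weight_gt0 q k a : 0 <= q -> 0 < a -> 0 < rejection_weight q k a.
Proof.
move=> q0 a0; elim: k => [|k ih]; first by rewrite rejection_weight0 ltr01.
by rewrite rejection_weightS ltr_wpDr // mulr_ge0 // ltW.
Qed.

End rejection_weight.

Section acceptance.
Context d (T : measurableType d) (R : realType) (P : probability T R).
Variable a : T -> R.
Hypothesis ma : measurable_fun setT a.
Local Open Scope ereal_scope.

Definition accept_prob : R := fine (\int[P]_w (a w)%:E).

Definition rejection_density (k : nat) (w : T) : R :=
  rejection_weight (1 - accept_prob) k (a w).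

Lemma accept_probE (l : R) : (0 <= l)%R -> (forall w, l <= a w <= 1)%R ->
  \int[P]_w (a w)%:E = accept_prob%:E.
Proof.
move=> l0 al1; have /andP[i0 i1] := integral_prob_bounds P ma l0 al1.
rewrite /accept_prob fineK // ge0_fin_numE ?(le_lt_trans i1) ?ltry //.
by apply: le_trans i0; rewrite lee_fin.
Qed.

Lemma accept_prob_bounds (l : R) : (0 <= l)%R -> (forall w, l <= a w <= 1)%R ->
  (l <= accept_prob <= 1)%R.
Proof.
move=> l0 al1; have := integral_prob_bounds P ma l0 al1.
by rewrite (accept_probE l0 al1) !lee_fin.
Qed.

Hypothesis a01 : forall w, (0 <= a w <= 1)%R.

Lemma integral_reject : \int[P]_w (1 - a w)%:E = (1 - accept_prob)%:E.
Proof.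
have a0 w : 0 <= (a w)%:E by rewrite lee_fin; have /andP[] := a01 w.
have ca0 w : 0 <= (1 - a w)%:E by rewrite lee_fin subr_ge0; have /andP[] := a01 w.
have mca : measurable_fun setT (fun w => (1 - a w)%:E).
  by apply/measurable_EFinP; apply: measurable_funB.
have : \int[P]_w (1 - a w)%:E + \int[P]_w (a w)%:E = 1.
  rewrite -ge0_integralD //; last exact/measurable_EFinP.
  by under eq_integral do rewrite -EFinD subrK; exact: integral_prob_cst.
by rewrite EFinB (accept_probE (lexx 0%R) a01) => <-; rewrite addeK.
Qed.

End acceptance.

Section one_trial.
Context (R : realType) d dO (T : measurableType d) (Om : measurableType dO).
Variables (P : probability T R) (Q : probability Om R).
Variables (a : T -> R) (out : Om -> T).
Hypothesis ma : measurable_fun setT a.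
Hypothesis a01 : forall w, 0 <= a w <= 1.
Local Open Scope ereal_scope.

Definition accept_or (w : (T * measurableTypeR R) * Om) : T :=
  if (w.1.2 <= a w.1.1)%R then w.1.1 else out w.2.

Definition trial_prob : probability ((T * measurableTypeR R) * Om)%type R :=
  (P \x unit_uniform R) \x Q.

Lemma measurable_accept_or : measurable_fun setT out -> measurable_fun setT accept_or.
Proof.
move=> mout.
have mprop : measurable_fun setT (fun w : (T * measurableTypeR R) * Om => w.1.1).
  exact: (measurableT_comp measurable_fst measurable_fst).
have munif : measurable_fun setT (fun w : (T * measurableTypeR R) * Om => w.1.2).
  exact: (measurableT_comp measurable_snd measurable_fst).
apply: measurable_fun_ifT => //; last exact: (measurableT_comp mout measurable_snd).
by apply: measurable_fun_ler => //; exact: (measurableT_comp ma mprop).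
Qed.

Lemma integral_accept_or (g : T -> \bar R) : measurable_fun setT out ->
  measurable_fun setT g -> (forall w, 0 <= g w) ->
  \int[trial_prob]_w g (accept_or w) =
  \int[P]_x (g x * (a x)%:E) + (1 - accept_prob P a)%:E * \int[Q]_w g (out w).
Proof.
move=> mout mg g0; set I := \int[Q]_w g (out w).
have I0 : 0 <= I by exact: integral_ge0.
have mgo : measurable_fun setT (fun w => g (accept_or w)).
  exact: (measurableT_comp mg (measurable_accept_or mout)).
rewrite /trial_prob fubini_tonelli1 //.
rewrite (eq_integral (fun e : T * measurableTypeR R =>
  if ((e.2 : R) <= a e.1)%R then g e.1 else I)); last first.
  by move=> e _; rewrite /fubini_F /accept_or /=; case: ifP => // _; rewrite integral_prob_cst.
rewrite fubini_tonelli1; last 2 first.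
- apply: measurable_fun_ifT.
  + by apply: measurable_fun_ler => //; exact: (measurableT_comp ma measurable_fst).
  + exact: (measurableT_comp mg measurable_fst).
  + exact: measurable_cst.
- by move=> e; case: ifP.
rewrite (eq_integral (fun w => g w * (a w)%:E + I * (1 - a w)%:E)); last first.
  by move=> w _; rewrite /fubini_F /= integral_unit_uniform_if.
have a0 w : 0 <= (a w)%:E by rewrite lee_fin; have /andP[] := a01 w.
have ca0 w : 0 <= (1 - a w)%:E by rewrite lee_fin subr_ge0; have /andP[] := a01 w.
have mca : measurable_fun setT (fun w => (1 - a w)%:E).
  by apply/measurable_EFinP; apply: measurable_funB.
rewrite ge0_integralD //; first by rewrite ge0_integralZl // integral_reject // muleC.
- by move=> w _; rewrite mule_ge0.
- by apply: emeasurable_funM => //; exact/measurable_EFinP.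
- by move=> w _; rewrite mule_ge0.
- exact: measurable_funeM.
Qed.

Lemma has_density_accept_or (rho : T -> R) : has_density Q P out rho ->
  has_density trial_prob P accept_or
    (fun x => a x + (1 - accept_prob P a) * rho x)%R.
Proof.
move=> [mout mrho rho0 dens]; set q := (1 - accept_prob P a)%R.
have q0 : (0 <= q)%R.
  by have := accept_prob_bounds P ma (lexx 0%R) a01; rewrite /q subr_ge0 => /andP[].
have a0 x : (0 <= a x)%R by have /andP[] := a01 x.
split; first exact: measurable_accept_or.
- by apply: measurable_funD => //; exact: measurable_funM.
- by move=> x; rewrite addr_ge0 // mulr_ge0.
move=> g mg g0; rewrite integral_accept_or // dens //.
have mga : measurable_fun setT (fun x => g x * (a x)%:E).
  by apply: emeasurable_funM => //; exact/measurable_EFinP.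
have mgrho : measurable_fun setT (fun x => g x * (rho x)%:E).
  by apply: emeasurable_funM => //; exact/measurable_EFinP.
have grho0 x : 0 <= g x * (rho x)%:E by rewrite mule_ge0 ?lee_fin.
have ga0 x : 0 <= g x * (a x)%:E by rewrite mule_ge0 ?lee_fin.
rewrite -ge0_integralZl // -ge0_integralD //; last 2 first.
- by move=> x _; rewrite mule_ge0 ?lee_fin.
- exact: measurable_funeM.
apply: eq_integral => x _.
by rewrite [in RHS]EFinD EFinM ge0_muleDr ?mule_ge0 ?lee_fin // muleCA.
Qed.

End one_trial.

Section first_accepted.
Context (R : numDomainType) (T Om : Type).
Implicit Types (x : nat -> Om -> T) (u : nat -> Om -> R) (a : T -> R).

(* If all k proposals are rejected, find returns k and the output is a fresh proposal. *)
Definition first_accepted k x u a (w : Om) : T :=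
  x (find (fun j => u j w <= a (x j w)) (iota 0 k)) w.

Lemma first_acceptedS k x u a w : first_accepted k.+1 x u a w =
  if u 0%N w <= a (x 0%N w) then x 0%N w
  else first_accepted k (x \o S) (u \o S) a w.
Proof.
by rewrite /first_accepted /=; case: ifP => // _; rewrite -[1%N]addn0 iotaDl find_map.
Qed.

End first_accepted.

Lemma rejection_sampler (R : realType) d (T : measurableType d) (P : probability T R)
    (k : nat) :
  exists dO (Om : measurableType dO) (Q : probability Om R)
    (x : nat -> Om -> T) (u : nat -> Om -> R),
  forall a : T -> R, measurable_fun setT a -> (forall w, 0 <= a w <= 1) ->
    has_density Q P (first_accepted k x u a) (rejection_density P a k).
Proof.
elim: k => [|k [dO [Om [Q [x [u ih]]]]]].
  exists d, T, P, (fun=> idfun), (fun _ _ => 0) => a ma a01.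
  rewrite (_ : rejection_density _ _ _ = cst 1); first exact: has_density_id.
  by apply/funext => w; rewrite /rejection_density rejection_weight0.
exists _, ((T * measurableTypeR R) * Om)%type, (trial_prob P Q),
  (fun j w => if j is j'.+1 then x j' w.2 else w.1.1),
  (fun j w => if j is j'.+1 then u j' w.2 else w.1.2) => a ma a01.
have := has_density_accept_or ma a01 (ih a ma a01).
congr (has_density _ _ _ _).
  by apply/funext => w; rewrite first_acceptedS.
by apply/funext => w; rewrite /rejection_density rejection_weightS.
Qed.

Section exponential_proposals.
Context (R : realType).
Implicit Types (t r e s w B : R).

Lemma exists_exprS_lt t e : 0 <= t < 1 -> 0 < e -> exists k, t ^+ k.+1 < e.
Proof.
move=> /andP[t0 t1] e0.
have : t ^+ n @[n --> \oo] --> (0 : R) by apply: cvg_expr; rewrite ger0_norm.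
move=> /cvgrPdist_lt/(_ e e0)[k _ hk]; exists k; have /= := hk k.+1 (leqnSn k).
by rewrite sub0r normrN ger0_norm // exprn_ge0.
Qed.

Lemma ln_expRD_bounds t r : 0 <= r -> 0 <= ln (expR t + r) - t <= r * expR (- t).
Proof.
move=> r0; have rt0 : 0 <= r * expR (- t) by rewrite mulr_ge0 ?expR_ge0.
have -> : expR t + r = expR t * (1 + r * expR (- t)).
  by rewrite mulrDr mulr1 mulrCA -expRD subrr expR0 mulr1.
rewrite lnM ?posrE ?expR_gt0 ?ltr_wpDr // expRK addrC addKr ln_ge0 ?lerDl //=.
by apply: le_ln1Dx; lra.
Qed.

Lemma affine_exp_near_exp s w B : 1 <= s -> 0 <= w ->
  exists (phi : R -> R) (c : R), [/\ measurable_fun setT phi,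
    forall t, `|t| <= B -> `|phi t - t| <= w * expR (2 * B) &
    forall t, expR (phi t + c) = s * expR (t - B) + w].
Proof.
move=> s1 w0; pose scale := s * expR (- B).
have scaleB : expR (- B) <= scale by rewrite ler_peMl // expR_ge0.
have scale0 : 0 < scale by rewrite (lt_le_trans _ scaleB) // expR_gt0.
have r0 : 0 <= w / scale by rewrite divr_ge0 // ltW.
exists (fun t => ln (expR t + w / scale)), (ln scale); split=> [|t|t].
- by apply: measurableT_comp => //; exact: measurable_funD.
- rewrite ler_norml => /andP[Bt _]; have /andP[ge0 le_r] := ln_expRD_bounds t r0.
  rewrite ger0_norm // (le_trans le_r) // -mulrA ler_wpM2l // mulrC ler_pdivrMr //.
  rewrite (le_trans _ (ler_wpM2l (expR_ge0 _) scaleB)) // -expRD ler_expR; lra.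
- rewrite expRD !lnK ?posrE ?ltr_wpDr ?expR_gt0 // mulrDl divfK ?gt_eqF //.
  by rewrite expRD mulrC -mulrA (mulrC (expR (- B))).
Qed.

(* The density of k + 1 rejection trials for exp f is affine in exp f, with a constant
   term that decays geometrically in k. *)
Lemma exp_density_sampler d (T : measurableType d) (P : probability T R) B e :
  0 <= B -> 0 < e ->
  exists dO (Om : measurableType dO) (Q : probability Om R),
  forall f : T -> R, measurable_fun setT f -> (forall x, `|f x| <= B) ->
  exists (X : Om -> T) (phi : R -> R) (c : R),
  [/\ measurable_fun setT phi, forall t, `|t| <= B -> `|phi t - t| <= e &
    has_density Q P X (fun x => expR (phi (f x) + c))].
Proof.
move=> B0 e0; set l := expR (- (2 * B)).
have l0 : 0 < l := expR_gt0 _.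
have l1 : l <= 1 by rewrite -expR0 ler_expR; lra.
have [||k lke] := @exists_exprS_lt (1 - l) (e * l); [lra|exact: mulr_gt0|].
have [dO [Om [Q [x [u dens]]]]] := rejection_sampler P k.+1.
exists dO, Om, Q => f mf fB; pose a y := expR (f y - B).
have ma : measurable_fun setT a.
  by apply: measurableT_comp => //; exact: measurable_funB.
have la y : l <= a y <= 1.
  have fBy : - B <= f y <= B by rewrite -ler_norml.
  by rewrite -[X in _ && (_ <= X)]expR0 !ler_expR; lra.
have a01 y : 0 <= a y <= 1 by have := la y; lra.
have := accept_prob_bounds P ma (ltW l0) la; set q := 1 - accept_prob P a => p1.
have q0 : 0 <= q by rewrite /q; lra.
have [phi [c [mphi phiB phiE]]] : exists (phi : R -> R) (c : R), [/\ measurable_fun setT phi,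
    forall t, `|t| <= B -> `|phi t - t| <= q ^+ k.+1 * expR (2 * B) &
    forall t, expR (phi t + c) = rejection_weight q k.+1 (expR (t - B))].
  apply: affine_exp_near_exp; last exact: exprn_ge0.
  by rewrite geom_sumS lerDl mulr_ge0 // geom_sum_ge0.
exists (first_accepted k.+1 x u a), phi, c; split=> //.
  move=> t tB; apply: (le_trans (phiB t tB)).
  rewrite -[2 * B]opprK expRN ler_pdivrMr // (le_trans _ (ltW lke)) //.
  by rewrite lerXn2r ?nnegrE /q; lra.
rewrite (_ : (fun _ => _) = rejection_density P a k.+1); first exact: dens.
by apply/funext => y; rewrite phiE.
Qed.

End exponential_proposals.

(** * The sup-log distance *)

Section log_ratio.
Context (R : realType).
Implicit Types (a p t c x y : R) (k : nat).

Definition rejection_error t k : R := if t <= 2^-1 then 2 * t ^+ k.+1 else t.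

Lemma abs_lnB_le c x y : 0 < c -> c <= x -> c <= y -> `|ln x - ln y| <= `|x - y| / c.
Proof.
wlog xy : x y / x <= y => [wl c0 cx cy|c0 cx cy].
  have [xy|/ltW yx] := leP x y; first exact: wl.
  by rewrite distrC (distrC x) wl.
have [x0 y0] : 0 < x /\ 0 < y by split; lra.
rewrite distrC (distrC x) !ger0_norm ?subr_ge0 ?ler_ln ?posrE // -ln_div ?posrE //.
have -> : y / x = 1 + (y - x) / x by field; rewrite gt_eqF.
have yx0 : 0 <= (y - x) / x by rewrite divr_ge0 ?subr_ge0 // ltW.
apply: le_trans (le_ln1Dx _) _; first lra.
by rewrite ler_wpM2l ?subr_ge0 // lef_pV2 ?posrE.
Qed.

Lemma ln_bounds_of_expRN_le t x : expR (- t) <= x <= 1 -> - t <= ln x <= 0.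
Proof.
move=> /andP[tx x1]; have x0 : 0 < x by apply: lt_le_trans tx; exact: expR_gt0.
by rewrite -[leLHS]expRK ler_ln ?posrE ?expR_gt0 // tx ln_le0.
Qed.

(* With q = 1 - p the denominator is (1 - q ^+ k) * a + q ^+ k * p, a convex combination
   of a and p that differs from a by q ^+ k * (p - a). *)
Lemma log_ratio_le_rejection_error a p t k : 0 <= t ->
  expR (- t) <= a <= 1 -> expR (- t) <= p <= 1 ->
  `|ln (a / (p * rejection_weight (1 - p) k a))| <= rejection_error t k.
Proof.
move=> t0 ta tp; set q := 1 - p; set D := p * _.
have expt : 1 - t <= expR (- t) by have := expR_ge1Dx (- t); lra.
have exp0 := expR_gt0 (- t).
have qt : 0 <= q <= t by rewrite /q; lra.
have qk : 0 <= q ^+ k <= 1 by rewrite exprn_ge0 ?exprn_ile1 // /q; lra.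
have DE : D = (1 - q ^+ k) * a + q ^+ k * p.
  by rewrite -mul1B_geom_sum /D /rejection_weight /q; ring.
have tD : expR (- t) <= D <= 1.
  by move: (q ^+ k) qk DE => r /andP[r0 r1] ->; apply/andP; split; nra.
have [a0 D0] : 0 < a /\ 0 < D by split; lra.
rewrite ln_div ?posrE // /rejection_error; case: ifP => [t2|_]; last first.
  have := ln_bounds_of_expRN_le ta; have := ln_bounds_of_expRN_le tD.
  by rewrite ler_norml; lra.
apply: (le_trans (@abs_lnB_le 2^-1 a D _ _ _)); rewrite ?invr_gt0 //; [lra|lra|].
rewrite invrK mulrC ler_wpM2l // DE.
have -> : a - ((1 - q ^+ k) * a + q ^+ k * p) = q ^+ k * (a - p) by ring.
rewrite normrM exprSr ler_pM //; last by rewrite ler_norml; lra.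
by rewrite ger0_norm ?lerXn2r ?nnegrE //; lra.
Qed.

End log_ratio.

Section suplog_of_densities.
Context (R : realType) (d : nat).
Variables (mu : {measure set 'rV[R]_d -> \bar R}).
Variables (target : set 'rV[R]_d -> \bar R) (p : 'rV[R]_d -> R).
Hypotheses (mp : measurable_fun setT p) (p_gt0 : forall x, 0 < p x).
Hypothesis targetE :
  forall A, measurable A -> target A = (\int[mu]_(x in A) (p x)%:E)%E.

Lemma D_suplog_le_of_density dO (Om : measurableType dO) (Q : probability Om R)
    (Y : {mfun Om >-> 'rV[R]_d}) (rho : 'rV[R]_d -> R) (e : R) :
  has_density Q mu Y rho -> (forall x, 0 < rho x) ->
  (forall x, `|ln (p x / rho x)| <= e) ->
  (D_suplog target (distribution Q Y) <= e%:E)%E.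
Proof.
move=> [mY mrho _ dens] rho0 he; apply: ereal_inf_lbound => /=.
pose h x := p x / rho x.
have h0 x : 0 < h x by exact: divr_gt0.
have mh : measurable_fun setT h.
  rewrite (_ : h = fun x => expR (ln (p x) - ln (rho x))); last first.
    by apply/funext => x; rewrite expRD expRN !lnK ?posrE.
  by apply: measurableT_comp => //; apply: measurable_funB; exact: measurableT_comp.
exists h; split=> // [A mA|]; last by apply: aeW => x; rewrite lee_fin; exact: he.
have mhA : measurable_fun setT ((EFin \o h) \_ A).
  by apply/(measurable_restrictT _ _).1 => //; apply: measurable_funTS; exact/measurable_EFinP.
have hA0 x : (0 <= ((EFin \o h) \_ A) x)%E.
  by rewrite patchE; case: ifP => // _; rewrite lee_fin ltW.
rewrite targetE // integral_mkcond [RHS]integral_mkcond.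
rewrite ge0_integral_distribution // dens //; apply: eq_integral => x _.
by rewrite !patchE; case: ifP => _; rewrite ?mul0e // -EFinM divfK // gt_eqF.
Qed.

Section rejection_from_proposals.
Context d0 (T : measurableType d0).
Variables (P : probability T R) (X : T -> 'rV[R]_d) (sigma : 'rV[R]_d -> R).
Variables (a : 'rV[R]_d -> R) (s t : R).
Hypotheses (target1 : target setT = 1%E) (densX : has_density P mu X sigma).
Hypotheses (ma : measurable_fun setT a) (t_ge0 : 0 <= t).
Hypotheses (ta : forall x, expR (- t) <= a x <= 1).
Hypothesis asp : forall x, a x * sigma x = s * p x.

Let a_gt0 x : 0 < a x.
Proof. by apply: lt_le_trans (expR_gt0 (- t)) _; have /andP[] := ta x. Qed.

Let maX : measurable_fun setT (a \o X).
Proof. by have [mX _ _ _] := densX; exact: measurableT_comp. Qed.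

Lemma accept_prob_proposals : accept_prob P (a \o X) = s.
Proof.
have [_ msigma sigma0 dens] := densX; apply: EFin_inj.
have s0 : 0 <= s.
  by rewrite -(pmulr_lge0 _ (p_gt0 (0 : 'rV[R]_d))) -asp mulr_ge0 // ltW.
rewrite -(accept_probE P maX (expR_ge0 (- t)) (fun w => ta (X w))).
rewrite (dens (EFin \o a)); last 2 first.
- exact/measurable_EFinP.
- by move=> x; rewrite lee_fin ltW.
under eq_integral do rewrite -EFinM asp EFinM.
rewrite ge0_integralZl //; first by rewrite -targetE // target1 mule1.
- exact/measurable_EFinP.
- by move=> x _; rewrite lee_fin ltW.
Qed.

Lemma D_suplog_rejection_le dO (Om : measurableType dO) (Q : probability Om R)
    (out : Om -> T) (Y : {mfun Om >-> 'rV[R]_d}) (k : nat) :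
  has_density Q P out (rejection_density P (a \o X) k) ->
  (Y : Om -> 'rV[R]_d) = X \o out ->
  (D_suplog target (distribution Q Y) <= (rejection_error t k)%:E)%E.
Proof.
move=> densOut YE.
have ts : expR (- t) <= s <= 1.
  rewrite -accept_prob_proposals.
  exact: (accept_prob_bounds P maX (expR_ge0 (- t)) (fun w => ta (X w))).
have [s0 q0] : 0 < s /\ 0 <= 1 - s by have := expR_gt0 (- t); split; lra.
pose weight x := rejection_weight (1 - s) k (a x).
have weight0 x : 0 < weight x by exact: rejection_weight_gt0.
have densY : has_density Q mu Y (fun x => weight x * sigma x).
  rewrite YE; apply: has_density_comp densX _ _ => [||x]; last exact: ltW.
    rewrite (_ : weight \o X = rejection_density P (a \o X) k) //.
    by apply/funext => w; rewrite /rejection_density accept_prob_proposals.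
  by apply: measurable_funD => //; exact: measurable_funM.
have sigmaE x : sigma x = s * p x / a x by rewrite -asp mulrAC divff ?mul1r ?gt_eqF.
apply: D_suplog_le_of_density densY _ _ => x.
  by rewrite mulr_gt0 // sigmaE divr_gt0 // mulr_gt0.
rewrite (_ : _ / _ = a x / (s * weight x)); first exact: log_ratio_le_rejection_error.
by rewrite sigmaE; field; rewrite !gt_eqF.
Qed.

End rejection_from_proposals.

End suplog_of_densities.

Section gibbs_density.
Context (R : realType) (d : nat) (f : 'rV[R]_d -> R) (B : R).
Let fc := f \o @clip R d.
Hypothesis mfc : measurable_fun setT fc.
Hypothesis fcB : forall x, `|fc x| <= B.
Local Open Scope ereal_scope.

Definition gibbs_density (x : 'rV[R]_d) : R := (expR (f (clip x)) / fine (Zf f))%R.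

Let mexp : measurable_fun setT (EFin \o expR \o fc).
Proof. by apply/measurable_EFinP; apply: measurableT_comp. Qed.

Lemma leb_int_exp (A : set 'rV[R]_d) : measurable A ->
  leb_int (fun x => ((\1_(A `&` @cube R d) x : R) * expR (f x))%:E) =
  \int[cube_prob R d]_(x in A) (expR (fc x))%:E.
Proof.
move=> mA; rewrite integral_mkcond integral_cube_prob; last 2 first.
- by apply/(measurable_restrictT _ _).1 => //; exact: measurable_funTS.
- by move=> x; rewrite patchE; case: ifP => // _; rewrite lee_fin expR_ge0.
congr leb_int; apply/funext => x; rewrite patchE setIC indicI /= !indicE.
case: (boolP (x \in @cube R d)) => [|_]; last by rewrite !mul0r mul0e.
rewrite inE => cx; rewrite /fc /= clip_id //.
by case: ifP; rewrite !mul1r ?mul1e ?mul0r.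
Qed.

Lemma ZfE : Zf f = \int[cube_prob R d]_x (expR (fc x))%:E.
Proof. by rewrite -(leb_int_exp measurableT) setTI. Qed.

Lemma Zf_bounds : (expR (- B))%:E <= Zf f <= (expR B)%:E.
Proof.
rewrite ZfE; apply: integral_prob_bounds => [||x]; [|exact: expR_ge0|].
  exact: measurableT_comp.
by rewrite !ler_expR -ler_norml.
Qed.

Lemma Zf_fin_num : Zf f \is a fin_num.
Proof.
have /andP[Z0 Z1] := Zf_bounds; rewrite ge0_fin_numE ?(le_lt_trans Z1) ?ltry //.
by apply: le_trans Z0; rewrite lee_fin expR_ge0.
Qed.

Lemma Zf_gt0 : (0 < fine (Zf f))%R.
Proof.
have := Zf_bounds; rewrite -(fineK Zf_fin_num) !lee_fin => /andP[+ _].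
exact: lt_le_trans (expR_gt0 _).
Qed.

Lemma gibbs_density_gt0 x : (0 < gibbs_density x)%R.
Proof. by rewrite divr_gt0 ?expR_gt0 ?Zf_gt0. Qed.

Lemma measurable_gibbs_density : measurable_fun setT gibbs_density.
Proof. by apply: measurable_funM => //; exact: measurableT_comp. Qed.

Lemma PfE (A : set 'rV[R]_d) : measurable A ->
  Pf f A = \int[cube_prob R d]_(x in A) (gibbs_density x)%:E.
Proof.
move=> mA; have exp0 x : A x -> 0 <= (expR (fc x))%:E by rewrite lee_fin expR_ge0.
have intA_fin : \int[cube_prob R d]_(x in A) (expR (fc x))%:E \is a fin_num.
  have intA_le : \int[cube_prob R d]_(x in A) (expR (fc x))%:E <= Zf f.
    by rewrite ZfE; apply: ge0_subset_integral => // x _; rewrite lee_fin expR_ge0.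
  have /andP[_ ZB] := Zf_bounds; rewrite ge0_fin_numE ?integral_ge0 //.
  by rewrite (le_lt_trans (le_trans intA_le ZB)) // ltry.
under eq_integral do rewrite EFinM.
rewrite ge0_integralZr //; last 2 first.
- exact: measurable_funTS.
- by rewrite lee_fin invr_ge0 ltW // Zf_gt0.
by rewrite /Pf leb_int_exp // EFinM fineK.
Qed.

Lemma Pf_setT : Pf f setT = 1.
Proof.
rewrite /Pf leb_int_exp // -ZfE divff //; exact: lt0r_neq0 Zf_gt0.
Qed.

End gibbs_density.

(** * The two-stage algorithm *)

Section two_stage_algorithm.
Context (R : realType) (d : nat) (Om T : Type).
Variables (G : seq 'rV[R]_d) (k : nat) (x : nat -> Om -> T) (u : nat -> Om -> R).
Variables (X : seq R -> T -> 'rV[R]_d) (ft : seq R -> 'rV[R]_d -> R) (eta : R).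

(* The list ys holds the values on G, followed by those at the proposals. *)
Definition two_stage_alg : stoch_alg R d Om :=
  @StochAlg R d Om
    (fun w ys => if (size ys < size G)%N then nth 0 G (size ys)
                 else X (take (size G) ys) (x (size ys - size G) w))
    (fun w ys => let D := take (size G) ys in
       X D (x (find (fun j => u j w <=
                 expR (nth 0 ys (size G + j) - ft D (X D (x j w)) - eta)) (iota 0 k)) w)).

Lemma two_stage_alg_in_cube : {in G, forall y, @cube R d y} ->
  (forall D v, @cube R d (X D v)) -> alg_in_cube two_stage_alg.
Proof.
move=> Gcube Xcube; split => w ys /=; last exact: Xcube.
by case: ifP => [lt_size|_]; [apply: Gcube; exact: mem_nth|exact: Xcube].
Qed.

Lemma infoS (A : stoch_alg R d Om) f w i :
  info A f w i.+1 = rcons (info A f w i) (f (next_pt A w (info A f w i))).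
Proof. by []. Qed.

Lemma info_first_stage f w i : (i <= size G)%N ->
  info two_stage_alg f w i = [seq f y | y <- take i G].
Proof.
elim: i => [|i ih] iG; first by rewrite take0.
rewrite infoS (ih (ltnW iG)) /=.
by rewrite size_map (size_takel (ltnW iG)) iG (take_nth 0) // map_rcons.
Qed.

Lemma info_second_stage f w j : let D := [seq f y | y <- G] in
  info two_stage_alg f w (size G + j) = D ++ [seq f (X D (x l w)) | l <- iota 0 j].
Proof.
move=> D; elim: j => [|j ih]; first by rewrite addn0 info_first_stage // take_size cats0.
have -> : iota 0 j.+1 = rcons (iota 0 j) j by rewrite -addn1 iotaD cats1.
rewrite map_rcons -rcons_cat addnS infoS ih; congr (rcons _ (f _)) => /=.
rewrite size_cat !size_map size_iota ltnNge leq_addr /= addKn.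
by rewrite take_size_cat ?size_map.
Qed.

Lemma sample_two_stage_alg f w : let D := [seq f y | y <- G] in
  sample two_stage_alg (size G + k) f w =
  X D (first_accepted k x u (fun v => expR (f (X D v) - ft D (X D v) - eta)) w).
Proof.
move=> D; rewrite /sample info_second_stage /= take_size_cat ?size_map //.
congr (X _ (x _ w)); apply: eq_in_find => j; rewrite mem_iota add0n => /andP[_ jk].
rewrite nth_cat size_map ltnNge leq_addr /= addKn.
by rewrite (nth_map 0%N) ?size_iota // nth_iota.
Qed.

End two_stage_algorithm.

Section fit.
Context (R : realType) (d : nat).
Variables (F : set ('rV[R]_d -> R)) (G : seq 'rV[R]_d) (B : R).
Hypotheses (B_ge0 : 0 <= B) (FB : forall f, F f -> forall x, `|f (clip x)| <= B).
Hypothesis mF : forall f, F f -> measurable_fun setT (f \o @clip R d).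

Definition fit (ys : seq R) : 'rV[R]_d -> R :=
  xget (fun=> 0) [set g | F g /\ [seq g y | y <- G] = ys].

Lemma fit_le ys x : `|fit ys (clip x)| <= B.
Proof. by rewrite /fit; case: xgetP => [g _ [Fg _]|_]; [exact: FB|rewrite normr0]. Qed.

Lemma measurable_fit ys : measurable_fun setT (fit ys \o @clip R d).
Proof. by rewrite /fit; case: xgetP => [g _ [Fg _]|_]; [exact: mF|exact: measurable_cst]. Qed.

Lemma fit_interpolates f : F f ->
  F (fit [seq f y | y <- G]) /\ {in G, f =1 fit [seq f y | y <- G]}.
Proof.
move=> Ff; rewrite /fit; case: xgetP => [g _ [Fg fg]|/(_ f)]; last by case.
by split=> //; apply/eq_in_map.
Qed.

End fit.

Section error_bound.
Context (R : realType) (d : nat).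
Implicit Types (B e eta : R).

Lemma exp_density_sampler_cube B e : 0 <= B -> 0 < e ->
  exists dT (T : measurableType dT) (P : probability T R),
  forall h : 'rV[R]_d -> R, measurable_fun setT (h \o @clip R d) ->
  (forall y, `|h (clip y)| <= B) ->
  exists (X : T -> 'rV[R]_d) (ft : 'rV[R]_d -> R) (c : R),
  [/\ forall v, @cube R d (X v), measurable_fun setT ft,
    forall y, `|ft y - h (clip y)| <= e &
    has_density P (cube_prob R d) X (fun y => expR (ft y + c))].
Proof.
move=> B0 e0.
have [dT [T [P sampler]]] := exp_density_sampler (cube_prob R d) B0 e0.
exists dT, T, P => h mh hB; have [X [phi [c [mphi phiB dens]]]] := sampler _ mh hB.
pose ft := phi \o (h \o @clip R d).
have mft : measurable_fun setT ft by exact: measurableT_comp.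
exists (@clip R d \o X), ft, c; split=> // [v|y|]; [exact: clip_cube|exact/phiB/hB|].
pose sigma y := expR (ft y + c).
have dens_clip : has_density P (cube_prob R d) X (sigma \o @clip R d).
  rewrite (_ : sigma \o _ = fun y => expR (phi ((h \o @clip R d) y) + c)) //.
  by apply/funext => y; rewrite /sigma /ft /= (clip_id (clip_cube y)).
rewrite (_ : (fun y => _) = (fun y => sigma y * cst 1 y)); last first.
  by apply/funext => y; rewrite mulr1.
apply: has_density_comp dens_clip (has_density_clip R d) _ _ => [|y]; last exact: expR_ge0.
by apply: measurableT_comp => //; exact: measurable_funD.
Qed.

Definition exp_acceptance (f ft : 'rV[R]_d -> R) eta y := expR (f (clip y) - ft y - eta).

Lemma measurable_exp_acceptance (f ft : 'rV[R]_d -> R) eta :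
  measurable_fun setT (f \o @clip R d) -> measurable_fun setT ft ->
  measurable_fun setT (exp_acceptance f ft eta).
Proof.
move=> mf mft; apply: measurableT_comp => //; apply: measurable_funB => //.
exact: (measurable_funB mf mft).
Qed.

Lemma exp_acceptance_bounds (f ft : 'rV[R]_d -> R) eta y :
  `|f (clip y) - ft y| <= eta -> expR (- (2 * eta)) <= exp_acceptance f ft eta y <= 1.
Proof.
rewrite ler_norml /exp_acceptance => fft.
by rewrite -[X in _ && (_ <= X)]expR0 !ler_expR; lra.
Qed.

Lemma D_suplog_Pf_rejection_le (f ft : 'rV[R]_d -> R) B eta (c : R)
    dT (T : measurableType dT) (P : probability T R) (X : T -> 'rV[R]_d)
    dO (Om : measurableType dO) (Q : probability Om R) (out : Om -> T)
    (Y : {mfun Om >-> 'rV[R]_d}) (k : nat) :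
  measurable_fun setT (f \o @clip R d) -> (forall y, `|f (clip y)| <= B) ->
  measurable_fun setT ft -> (forall y, `|f (clip y) - ft y| <= eta) ->
  has_density P (cube_prob R d) X (fun y => expR (ft y + c)) ->
  has_density Q P out (rejection_density P (exp_acceptance f ft eta \o X) k) ->
  (Y : Om -> 'rV[R]_d) = X \o out ->
  (D_suplog (Pf f) (distribution Q Y) <= (rejection_error (2 * eta) k)%:E)%E.
Proof.
move=> mf fB mft fft densX densOut YE; have Z0 := Zf_gt0 mf fB.
have eta0 : 0 <= eta := le_trans (normr_ge0 _) (fft 0).
apply: (@D_suplog_rejection_le R d (cube_prob R d) (Pf f) (gibbs_density f) _ _ _
  _ _ P X _ (exp_acceptance f ft eta) (expR (c - eta) * fine (Zf f)) _ _ densX) YE => //.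
- exact: measurable_gibbs_density.
- by move=> y; exact: gibbs_density_gt0 mf fB y.
- by move=> A; exact: PfE mf fB A.
- exact: Pf_setT mf fB.
- exact: measurable_exp_acceptance.
- by rewrite mulr_ge0.
- by move=> y; exact: exp_acceptance_bounds.
- move=> y; rewrite /exp_acceptance /gibbs_density [RHS]mulrCA mulfK ?gt_eqF // -!expRD.
  by congr expR; ring.
Qed.

Section error_over_class.
Variables (F : set ('rV[R]_d -> R)) (G : seq 'rV[R]_d) (B : R).
Hypothesis mF : forall f, F f -> measurable_fun setT (f \o @clip R d).
Hypothesis FB : forall f, F f -> forall y, `|f (clip y)| <= B.

Lemma proposals_near_class e : 0 <= B -> 0 < e ->
  (forall f g, F f -> F g -> {in G, f =1 g} ->
     forall y, `|f (clip y) - g (clip y)| <= e) ->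
  exists dT (T : measurableType dT) (P : probability T R)
    (X : seq R -> T -> 'rV[R]_d) (ft : seq R -> 'rV[R]_d -> R) (c : seq R -> R),
  [/\ forall D v, @cube R d (X D v), forall D, measurable_fun setT (ft D),
    forall D, has_density P (cube_prob R d) (X D) (fun y => expR (ft D y + c D)) &
    forall f, F f -> forall y, `|f (clip y) - ft [seq f y | y <- G] y| <= 2 * e].
Proof.
move=> B0 e0 Gclose; have [dT [T [P sampler]]] := exp_density_sampler_cube B0 e0.
have /choice[S hS] D : exists S : (T -> 'rV[R]_d) * ('rV[R]_d -> R) * R,
  [/\ forall v, @cube R d (S.1.1 v), measurable_fun setT S.1.2,
    forall y, `|S.1.2 y - fit F G D (clip y)| <= e &
    has_density P (cube_prob R d) S.1.1 (fun y => expR (S.1.2 y + S.2))].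
  have [X [ft [c ?]]] := sampler _ (measurable_fit G mF D) (fit_le G B0 FB D).
  by exists (X, ft, c).
exists dT, T, P, (fun D => (S D).1.1), (fun D => (S D).1.2), (fun D => (S D).2).
split=> [D|D|D|f Ff y]; try by have [] := hS D.
have [Ffit fit_eq] := fit_interpolates G Ff.
have [_ _ /(_ y) + _] := hS [seq f y | y <- G].
by have := Gclose _ _ Ff Ffit fit_eq y; rewrite !ler_norml; lra.
Qed.

Lemma two_stage_alg_error dT (T : measurableType dT) (P : probability T R)
    (X : seq R -> T -> 'rV[R]_d) (ft : seq R -> 'rV[R]_d -> R) (c : seq R -> R) eta
    (k : nat) :
  {in G, forall y, @cube R d y} -> (forall D v, @cube R d (X D v)) ->
  (forall D, measurable_fun setT (ft D)) ->
  (forall D, has_density P (cube_prob R d) (X D) (fun y => expR (ft D y + c D))) ->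
  (forall f, F f -> forall y, `|f (clip y) - ft [seq f y | y <- G] y| <= eta) ->
  (@err_adstoch R d (size G + k) F <= (rejection_error (2 * eta) k)%:E)%E.
Proof.
move=> Gcube Xcube mft densX close.
have mX D : measurable_fun setT (X D) by have [] := densX D.
have [dO [Om [Q [x [u trials]]]]] := rejection_sampler P k.
pose A := two_stage_alg G k x u X ft eta.
pose D (f : 'rV[R]_d -> R) := [seq f y | y <- G].
pose a f := exp_acceptance f (ft (D f)) eta \o X (D f).
have sampleE f : sample A (size G + k) f = X (D f) \o first_accepted k x u (a f).
  apply/funext => w; rewrite /A sample_two_stage_alg.
  congr (X _ (first_accepted _ _ _ _ w)); apply/funext => v.
  by rewrite /a /exp_acceptance /= clip_id.
have densOut f : F f ->
    has_density Q P (first_accepted k x u (a f)) (rejection_density P (a f) k).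
  move=> Ff; apply: trials => [|v]; last first.
    have /andP[_ a1] := exp_acceptance_bounds (close f Ff (X (D f) v)).
    by rewrite expR_ge0.
  by apply: measurableT_comp => //; apply: measurable_exp_acceptance => //; exact: mF.
apply: (@le_trans _ _ (alg_error Q A (size G + k) F)).
  apply: ereal_inf_lbound; exists dO, Om, Q, A; split=> // [|f Ff].
    exact: two_stage_alg_in_cube.
  by rewrite sampleE; apply: measurableT_comp => //; have [] := densOut f Ff.
apply: ge_ereal_sup => _ [f [Ff [Y [YE ->]]]].
apply: D_suplog_Pf_rejection_le (mF Ff) (FB Ff) _ (close f Ff) (densX _)
  (densOut f Ff) _ => //.
by rewrite YE sampleE.
Qed.

Lemma err_adstoch_le_rejection_error e (k : nat) : 0 <= B -> 0 < e ->
  {in G, forall y, @cube R d y} ->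
  (forall f g, F f -> F g -> {in G, f =1 g} ->
     forall y, `|f (clip y) - g (clip y)| <= e) ->
  (@err_adstoch R d (size G + k) F <= (rejection_error (4 * e) k)%:E)%E.
Proof.
move=> B0 e0 Gcube Gclose; rewrite (_ : 4 * e = 2 * (2 * e)); last by ring.
have [dT [T [P [X [ft [c [Xcube mft densX close]]]]]]] := proposals_near_class B0 e0 Gclose.
exact: two_stage_alg_error Gcube Xcube mft densX close.
Qed.

End error_over_class.

Lemma rejection_error_le_powR (t : R) (k n : nat) : 0 < t -> t <= 2^-1 -> (n <= k.*2)%N ->
  rejection_error t k <= (2 * t) `^ (n%:R / 2 + 1).
Proof.
move=> t0 t2 nk; rewrite /rejection_error t2.
apply: (@le_trans _ _ ((2 * t) ^+ k.+1)).
  rewrite exprMn; apply: ler_wpM2r; first by rewrite exprn_ge0 // ltW.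
  by rewrite exprS ler_peMr // exprn_ege1 // ler1n.
have t01 : 0 < 2 * t <= 1 by lra.
rewrite -powR_mulrn ?mulr_ge0 ?(ltW t0) //; apply: (ger_powR t01).
have : n%:R <= k.*2%:R :> R by rewrite ler_nat.
by rewrite -muln2 natrM -[k.+1%:R]natr1; lra.
Qed.

End error_bound.

Theorem theorem9 (R : realType) (d m : nat) :
  (1 <= d)%N -> (1 <= m)%N ->
  exists C C' : R, 0 < C /\ 0 < C' /\
    forall (B : R) (n : nat), 0 < B -> (1 <= n)%N ->
      let r := C * B * (n%:R `^ (- (m%:R / d%:R))) in
      (1 < r -> (@err_adstoch R d n (@Fclass R d m B) <= (C' * B * (n%:R `^ (- (m%:R / d%:R))))%:E)%E) /\
      (r <= 1 -> (@err_adstoch R d n (@Fclass R d m B) <= (C' * r `^ (n%:R / 2 + 1))%:E)%E).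
Proof.
move=> d_gt0 _; have [c c0 grid] := grid_approximation R m d_gt0.
exists (8 * c), (1 + 4 * c); split; first by rewrite mulr_gt0.
split=> [|B n B0 n0]; first by rewrite addr_gt0 ?mulr_gt0.
have [G [Gsize Gcube Gclose]] := grid n n0; pose k := (n - size G)%N.
have [nE nk] : n = (size G + k)%N /\ (n <= k.*2)%N.
  by have := odd_double_half n; rewrite /k; lia.
set b := B * n%:R `^ (- (m%:R / d%:R)).
have b0 : 0 < b by rewrite mulr_gt0 ?powR_gt0 ?ltr0n.
have cb0 : 0 < c * b by exact: mulr_gt0.
have := err_adstoch_le_rejection_error (@Fclass_measurable_clip R d m B)
  (@Fclass_le R d m B) k (ltW B0) cb0 Gcube (Gclose B).
rewrite -nE => err.
have rE : 8 * c * B * n%:R `^ (- (m%:R / d%:R)) = 2 * (4 * (c * b)) by rewrite /b; ring.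
rewrite rE -(mulrA _ B) -/b; split=> r1; apply: (le_trans err); rewrite lee_fin.
  by rewrite /rejection_error ifF; [nra|apply/negbTE; rewrite -ltNge; lra].
apply: le_trans (rejection_error_le_powR _ _ nk) _; [by rewrite mulr_gt0|lra|].
by rewrite ler_peMl ?powR_ge0 // lerDl mulr_ge0 // ltW.
Qed.
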